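(* Let $\mathcal O$ be an Adem-Cartan operad. The cohomology $H^*(A)$ of any $\mathcal O$-algebra $A$, with product $[a]*[b]=[e_0(a,b)]$ and operations $\mathrm{Sq}^r([a])=[e_{|a|-r}(a,a)]$ ($r\in\mathbb Z$, $e_i=0$ for $i<0$), is an unstable level algebra over the extended Steenrod algebra $\mathcal B_2$.
   Context: The ground field is $\mathbb F_2$; ''vector space'' means differential $\mathbb Z$-graded $\mathbb F_2$-vector space with differential of degree $+1$. A permutation $\sigma\in\Sigma_n$ is written $(\sigma(1)\ldots\sigma(n))$; products are compositions of functions. An operad $\mathcal O=\{\mathcal O(n)\}_{n>0}$ consists of right differential graded $\mathbb F_2[\Sigma_n]$-modules with $\mathcal O(1)=\mathbb F_2$ and associative, unital, equivariant compositions, with $(o\cdot\sigma)(a_1,\ldots,a_n)=o(a_{\sigma^{-1}(1)},\ldots,a_{\sigma^{-1}(n)})\cdot\sigma(i_1,\ldots,i_n)$ (block permutation). An $\mathcal O$-algebra $A$ is a vector space with associative, equivariant evaluation maps $\mathcal O(n)\otimes A^{\otimes n}\to A$ (chain maps), $(o\cdot\sigma)(a_1,\ldots,a_n)=o(a_{\sigma^{-1}(1)},\ldots,a_{\sigma^{-1}(n)})$. $\mathcal E$: free operad on the $\Sigma_2$-module with basis over $\mathbb F_2[\Sigma_2]$ given by $e_i$ in degree $-i$, $i\ge0$, $d(e_i)=e_{i-1}+e_{i-1}\cdot(21)$, $e_{i}=0$ for $i<0$. For integers $i,j$, $(i,j)=\frac{(i+j)!}{i!\,j!}\in\mathbb F_2$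 if $i,j\ge0$, and $0$ otherwise. For $m>0$ with $2^k\le m\le 2^{k+1}-1$, $[u^m_n]_x\in\mathcal E(4)^{-n-x}$ is: $[u^m_n]_x=0$ if $n<0$; $[u^m_0]_x=(e_x\cdot(21)^{m-1})(e_0,e_0)$; and for $n>0$ $$[u^m_n]_x=\sum_{i=0}^{2^{k+1}-1}\ \sum_{\delta:\,0\le 2^{k+1}\delta-i\le n}(n-m+i,m-1)\Big[(i,m)\,(e_x\cdot(21)^{m-1})(e_{2^{k+1}\delta-i},e_{n+i-2^{k+1}\delta})+(i-1,m)\,(e_x\cdot(21)^{m-1})(e_{2^{k+1}\delta-i},e_{n+i-2^{k+1}\delta}\cdot(21))\Big].$$ For $p\in\mathbb Z$, $\alpha_{n,p}=\sum_{s=0}^{n-p}[u^{s+1}_{s+p}]_{n-s-p}+\sum_{s=0}^{n-p-1}[u^{s+1}_{s+p+1}]_{n-s-p-1}\cdot(3412)\in\mathcal E(4)^{-n}$. $\mathcal{L}ev^{AC}$ is the operad which, forgetting the differential, is the free operad on the $\Sigma_2$-module $\mathcal E(2)$ and the free $\Sigma_4$-module on elements $G^m_n$ of degree $-n$, $n\ge m\ge1$, with differential extending that of $\mathcal E$ and given, with $p=\lfloor\frac{m-1}2\rfloor$ and $G^m_n=0$ if $m\le0$ or $n<m$, by $$dG^m_m=G^{m-1}_{m-1}\cdot(3214)(\mathrm{Id}+(2143))+G^{m-2}_{m-1}\cdot(\mathrm{Id}+(4321))+\alpha_{m-1,m-1-p}+\alpha_{m-1,p}\cdot(3214),$$ $$dG^m_n=G^m_{n-1}\cdot(\mathrm{Id}+(2143))+G^{m-2}_{n-1}\cdot(\mathrm{Id}+(4321))+\alpha_{n-1,n-1-p}+\alpha_{n-1,p}\cdot(3214)\quad(n>m).$$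 An Adem-Cartan operad is an operad $\mathcal O$ such that $\mathcal O(2)$ is a $\Sigma_2$-projective resolution of $\mathbb F_2$, together with a morphism of operads $m:\mathcal{L}ev^{AC}\to\mathcal O$ such that $m(2)$ is a quasi-isomorphism. The images of $e_i$ in $\mathcal O(2)$ are again denoted $e_i$. The extended Steenrod algebra $\mathcal B_2$ is the graded associative $\mathbb F_2$-algebra generated by $\mathrm{Sq}^i$ of degree $i$, $i\in\mathbb Z$, subject to the Adem relations $\mathrm{Sq}^t\mathrm{Sq}^s=\sum_i\binom{s-i-1}{t-2i}\mathrm{Sq}^{s+t-i}\mathrm{Sq}^i$ for $t<2s$ (binomials $\binom ab$ vanish unless $0\le b\le a$; $\mathrm{Sq}^0=\mathrm{Id}$ is not assumed). A level algebra is a vector space with a commutative (not necessarily associative) product $*$ with $(a*b)*(c*d)=(a*c)*(b*d)$. An unstable level algebra over $\mathcal B_2$ is a graded level algebra $(A,* )$ that is a graded $\mathcal B_2$-module with $\mathrm{Sq}^n(x)=0$ if $|x|<n$, $\mathrm{Sq}^{|x|}(x)=x*x$, and $\mathrm{Sq}^s(x*y)=\sum_{t}\mathrm{Sq}^t(x)*\mathrm{Sq}^{s-t}(y)$. *)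

(* Defs.v *)
From HB Require Import structures.
From mathcomp Require Import all_boot all_order all_algebra all_fingroup.
From mathcomp Require Import zify.
From mathcomp Require Import boolp classical_sets fsbigop.

Set Implicit Arguments.
Unset Strict Implicit.
Unset Printing Implicit Defensive.

Import Order.TTheory GRing.Theory Num.Theory.
Local Open Scope ring_scope.
Local Open Scope quotient_scope.

(* A Z-graded space is encoded as the direct sum of its homogeneous parts:
   [gcomp p] is the projection onto the part of degree p. *)
Record gradedSpace := GradedSpace {
  gcarrier :> lmodType 'F_2;
  gcomp : int -> {linear gcarrier -> gcarrier};
  gcompK : forall p q x,
    gcomp p (gcomp q x) = if p == q then gcomp q x else 0;
  gcomp_sum : forall x,
    exists2 s : seq int, uniq s & x = \sum_(p <- s) gcomp p x }.

Definition homog (V : gradedSpace) (p : int) (x : V) : Prop :=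
  gcomp V p x = x.

Record dgSpace := DgSpace {
  dg_graded :> gradedSpace;
  diff : {linear dg_graded -> dg_graded};
  diff_deg : forall p x, diff (gcomp dg_graded p x) =
                         gcomp dg_graded (p + 1) (diff x);
  diffK : forall x, diff (diff x) = 0 }.

Section Cocycles.
Variable V : dgSpace.

Definition cocycleb : {pred V} := [pred x | diff V x == 0].

Fact cocycleb_submod : submod_closed cocycleb.
Proof.
split=> [|c x y]; rewrite !inE ?linear0 //.
by move=> /eqP dx /eqP dy; rewrite linearP dx dy scaler0 addr0.
Qed.
HB.instance Definition _ := GRing.isSubmodClosed.Build _ V cocycleb
  cocycleb_submod.

Definition cocycle := {x : V | x \in cocycleb}.
HB.instance Definition _ := Choice.on cocycle.
HB.instance Definition _ := SubType.on cocycle.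
HB.instance Definition _ := [SubChoice_isSubZmodule of cocycle by <:].
HB.instance Definition _ := [SubZmodule_isSubLmodule of cocycle by <:].

Definition boundaryb : {pred cocycle} :=
  [pred z : cocycle | `[< exists y : V, val z = diff V y >] ].

Fact boundaryb_submod : submod_closed boundaryb.
Proof.
split=> [|c x y]; rewrite !inE; first by exists 0; rewrite !linear0.
by move=> [x' xE] [y' yE]; exists (c *: x' + y'); rewrite linearP -xE -yE.
Qed.
HB.instance Definition _ := GRing.isSubmodClosed.Build _ cocycle boundaryb
  boundaryb_submod.

Definition cohomology := Quotient.quot boundaryb.
HB.instance Definition _ := GRing.Zmodule.on cohomology.

Definition coh_class (z : cocycle) : cohomology := \pi_cohomology z.

Lemma coh_classP (x y : cocycle) :
  coh_class x = coh_class y <-> exists w, val x - val y = diff V w.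
Proof.
have <- : (x - y \in boundaryb) <-> exists w, val x - val y = diff V w.
  by rewrite inE; split=> -[w wE]; exists w; rewrite -wE linearB.
by rewrite Quotient.idealrBE; split=> /eqP.
Qed.

Fact coh_classK (h : cohomology) : coh_class (generic_quotient.repr h) = h.
Proof. exact: reprK. Qed.

Fact coh_classD : {morph coh_class : x y / x + y}.
Proof. by move=> x y; rewrite /coh_class Quotient.pi_add. Qed.

Definition coh_scale (c : 'F_2) (h : cohomology) : cohomology :=
  coh_class (c *: generic_quotient.repr h).

Fact coh_class_scale c z : coh_class (c *: z) = coh_scale c (coh_class z).
Proof.
have [w wE] := (coh_classP _ _).1 (coh_classK (coh_class z)).
apply/coh_classP; exists (- (c *: w)).
by rewrite [RHS]linearN [in RHS]linearZ -wE /= scalerBr opprB.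
Qed.

Fact coh_scaleA a b h : coh_scale a (coh_scale b h) = coh_scale (a * b) h.
Proof. by rewrite -(coh_classK h) -!coh_class_scale scalerA. Qed.
Fact coh_scale1 : left_id 1 coh_scale.
Proof. by move=> h; rewrite -(coh_classK h) -coh_class_scale scale1r. Qed.
Fact coh_scaleDr : right_distributive coh_scale +%R.
Proof.
move=> a h k; rewrite -(coh_classK h) -(coh_classK k) -coh_classD.
by rewrite -!coh_class_scale -coh_classD scalerDr.
Qed.
Fact coh_scaleDl h : {morph coh_scale^~ h : a b / a + b}.
Proof.
by move=> a b; rewrite -(coh_classK h) -!coh_class_scale -coh_classD scalerDl.
Qed.
HB.instance Definition _ := GRing.Zmodule_isLmodule.Build 'F_2 cohomology
  coh_scaleA coh_scale1 coh_scaleDr coh_scaleDl.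

Fact coh_class_linear : linear coh_class.
Proof. by move=> c x y; rewrite coh_classD coh_class_scale. Qed.
HB.instance Definition _ :=
  GRing.isLinear.Build 'F_2 cocycle cohomology _ coh_class coh_class_linear.

Fact cocycle_comp_subproof p (z : cocycle) : gcomp V p (val z) \in cocycleb.
Proof.
have /eqP dz := valP z; rewrite inE.
have : forall q, gcomp V q (diff V (gcomp V p (val z))) = 0.
  move=> q; have := diff_deg (q - 1) (gcomp V p (val z)).
  rewrite subrK => <-; rewrite gcompK; case: eqP => [_|_]; last by rewrite linear0.
  by rewrite diff_deg dz linear0.
by move=> c0; have [s _ ->] := gcomp_sum (diff V (gcomp V p (val z)));
  rewrite big1.
Qed.

Definition cocycle_comp p (z : cocycle) : cocycle :=
  Sub (gcomp V p (val z)) (cocycle_comp_subproof p z).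

Fact cocycle_compE p z : val (cocycle_comp p z) = gcomp V p (val z).
Proof. by []. Qed.

Definition coh_comp p (h : cohomology) : cohomology :=
  coh_class (cocycle_comp p (generic_quotient.repr h)).

Fact coh_comp_class p z : coh_comp p (coh_class z) = coh_class (cocycle_comp p z).
Proof.
have [w wE] := (coh_classP _ _).1 (coh_classK (coh_class z)).
apply/coh_classP; exists (gcomp V (p - 1) w).
by rewrite diff_deg subrK -wE linearB !cocycle_compE.
Qed.

Fact coh_comp_linear p : linear (coh_comp p).
Proof.
move=> c h k; rewrite -(coh_classK h) -(coh_classK k) -linearP !coh_comp_class.
by rewrite -linearP; congr coh_class; apply: val_inj; rewrite cocycle_compE !linearP.
Qed.
HB.instance Definition _ p :=
  GRing.isLinear.Build 'F_2 cohomology cohomology _ (coh_comp p)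
    (coh_comp_linear p).

Fact coh_compK p q h :
  coh_comp p (coh_comp q h) = if p == q then coh_comp q h else 0.
Proof.
rewrite -(coh_classK h) !coh_comp_class.
case: ifPn => pq; last rewrite -(linear0 coh_class).
  by congr coh_class; apply: val_inj; rewrite !cocycle_compE gcompK pq.
by congr coh_class; apply: val_inj; rewrite !cocycle_compE gcompK (negPf pq) linear0.
Qed.

Fact coh_comp_sum h :
  exists2 s : seq int, uniq s & h = \sum_(p <- s) coh_comp p h.
Proof.
have [s us sE] := gcomp_sum (val (generic_quotient.repr h)); exists s => //.
rewrite -{1}(coh_classK h) /coh_comp -linear_sum; congr coh_class.
by apply: val_inj; rewrite linear_sum {1}sE; apply: eq_bigr.
Qed.

Definition coh : gradedSpace :=
  GradedSpace (gcomp := fun p => coh_comp p : {linear _ -> _})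
    coh_compK coh_comp_sum.

Definition has_class (a : V) (x : coh) : Prop :=
  exists2 z : cocycle, val z = a & coh_class z = x.

End Cocycles.

Definition quasi_iso (V W : dgSpace) (f : V -> W) : Prop :=
  exists g : coh V -> coh W,
    bijective g /\ forall a x, has_class a x -> has_class (f a) (g x).

(* A right F_2[Sigma_n]-module.  Permutations are multiplied as functions,
   whereas the product of MathComp is [(s * t) i = t (s i)], whence the order
   of the factors in [sact_mul]. *)
Record symModule (n : nat) := SymModule {
  scarrier :> lmodType 'F_2;
  sact : 'S_n -> {linear scarrier -> scarrier};
  sact1 : forall x, sact 1%g x = x;
  sact_mul : forall s t x, sact (t * s)%g x = sact t (sact s x) }.

Definition equivariant n (M N : symModule n) (f : M -> N) : Prop :=
  forall s x, f (sact M s x) = sact N s (f x).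

Definition projective n (P : symModule n) : Prop :=
  forall (M N : symModule n) (f : {linear M -> N}) (g : {linear P -> N}),
    equivariant f -> equivariant g -> (forall y, exists x, f x = y) ->
    exists2 h : {linear P -> M}, equivariant h & forall x, f (h x) = g x.

Section DegreePart.
Variables (V : gradedSpace) (p : int).

Definition degree_pred : {pred V} := [pred x | gcomp V p x == x].

Fact degree_pred_submod : submod_closed degree_pred.
Proof.
split=> [|c x y]; rewrite !inE ?linear0 //.
by move=> /eqP dx /eqP dy; rewrite linearP dx dy.
Qed.
HB.instance Definition _ := GRing.isSubmodClosed.Build _ V degree_pred
  degree_pred_submod.

Definition degree_part := {x : V | x \in degree_pred}.
HB.instance Definition _ := Choice.on degree_part.
HB.instance Definition _ := SubType.on degree_part.
HB.instance Definition _ := [SubChoice_isSubZmodule of degree_part by <:].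
HB.instance Definition _ := [SubZmodule_isSubLmodule of degree_part by <:].

Section DegreePartAction.
Variables (n : nat) (act : 'S_n -> {linear V -> V}).
Hypothesis act1 : forall x, act 1%g x = x.
Hypothesis act_mul : forall s t x, act (t * s)%g x = act t (act s x).
Hypothesis act_deg : forall s q x, act s (gcomp V q x) = gcomp V q (act s x).

Fact part_act_subproof s (x : degree_part) : act s (val x) \in degree_pred.
Proof. by have /eqP dx := valP x; rewrite inE -act_deg dx. Qed.

Definition part_act s (x : degree_part) : degree_part :=
  Sub (act s (val x)) (part_act_subproof s x).

Fact part_act_linear s : linear (part_act s).
Proof. by move=> c x y; apply: val_inj; rewrite /= !linearP. Qed.
HB.instance Definition _ s :=
  GRing.isLinear.Build 'F_2 degree_part degree_part _ (part_act s)
    (part_act_linear s).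

Fact part_act1 x : part_act 1%g x = x.
Proof. by apply: val_inj; rewrite /= act1. Qed.
Fact part_act_mul s t x : part_act (t * s)%g x = part_act t (part_act s x).
Proof. by apply: val_inj; rewrite /= act_mul. Qed.

Definition part_symModule : symModule n :=
  SymModule (sact := fun s => part_act s : {linear _ -> _})
    part_act1 part_act_mul.

End DegreePartAction.
End DegreePart.

(* In MathComp, [tagnat.Rank j l] is the position of the [l]-th entry of the
   [j]-th block in the concatenation of blocks of lengths [k 0], [k 1], ...;
   [tagnat.sig1] and [tagnat.sig2] return the block and the entry. *)

Fact sum_arity_perm n (k : 'I_n -> nat) (s : 'S_n) :
  (\sum_(j < n) k j)%N = (\sum_(i < n) k (s i))%N.
Proof. by rewrite (reindex_inj (@perm_inj _ s)). Qed.

(* The block permutation [s (k (s 0), ..., k (s n.-1))]: it sends the [l]-th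
   entry of the [i]-th block, which has length [k (s i)], to the [l]-th entry of
   the [s i]-th block of the reordered sequence of blocks. *)
Definition block_perm_fun n (k : 'I_n -> nat) (s : 'S_n)
    (x : 'I_(\sum_(j < n) k j)%N) : 'I_(\sum_(j < n) k j)%N :=
  let x' := cast_ord (sum_arity_perm k s) x in
  tagnat.Rank (p_ := k) (s (tagnat.sig1 x')) (tagnat.sig2 x').

Fact block_perm_inj n (k : 'I_n -> nat) s : injective (@block_perm_fun n k s).
Proof.
move=> x y E; apply: (@cast_ord_inj _ _ (sum_arity_perm k s)).
move: E; rewrite /block_perm_fun.
set x' := cast_ord _ x; set y' := cast_ord _ y => E.
have E1 : tagnat.sig1 x' = tagnat.sig1 y'.
  by apply: (@perm_inj _ s); have := congr1 (@tagnat.sig1 _ _) E;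
     rewrite !tagnat.Rank1K.
have E2 : tagnat.sig2 x' = tagnat.sig2 y' :> nat.
  by have := congr1 (fun z => tagnat.sig2 z : nat) E; rewrite !tagnat.Rank2K.
by apply: ord_inj; rewrite (tagnat.rect x') (tagnat.rect y') E2 E1.
Qed.

Definition block_perm n (k : 'I_n -> nat) (s : 'S_n) :
  'S_(\sum_(j < n) k j)%N := perm (@block_perm_inj n k s).

Definition direct_sum_perm_fun n (k : 'I_n -> nat) (t : forall i, 'S_(k i))
    (x : 'I_(\sum_(j < n) k j)%N) : 'I_(\sum_(j < n) k j)%N :=
  tagnat.Rank (tagnat.sig1 x) (t (tagnat.sig1 x) (tagnat.sig2 x)).

Fact direct_sum_perm_inj n (k : 'I_n -> nat) t :
  injective (@direct_sum_perm_fun n k t).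
Proof.
apply: (can_inj (g := direct_sum_perm_fun (fun i => (t i)^-1%g))) => x.
rewrite /direct_sum_perm_fun; set i := tagnat.sig1 x; set j := t i _.
have sigE : tagnat.sig (tagnat.Rank i j) = Tagged (fun i => 'I_(k i)) j.
  by rewrite tagnat.rankK.
by rewrite /tagnat.sig1 /tagnat.sig2 sigE /= permK tagnat.sig2K.
Qed.

Definition direct_sum_perm n (k : 'I_n -> nat) (t : forall i, 'S_(k i)) :
  'S_(\sum_(j < n) k j)%N := perm (@direct_sum_perm_inj n k t).

(* Operads have arities n > 0; this is encoded by [P 0 = 0].  Operations of
   propositionally equal arities are compared in [{n & P n}]. *)
Record gradedOperad := GradedOperad {
  oper :> nat -> gradedSpace;
  oact : forall n, 'S_n -> {linear oper n -> oper n};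
  oid : oper 1%N;
  ocomp : forall n (k : 'I_n -> nat),
    oper n -> (forall i, oper (k i)) -> oper (\sum_(i < n) k i)%N;

  oper0 : forall x : oper 0%N, x = 0;
  oper1 : forall x : oper 1%N, exists c : 'F_2, x = c *: oid;
  oid_neq0 : oid != 0;
  oid_deg : homog 0 oid;

  oact1 : forall n (o : oper n), oact 1%g o = o;
  oact_mul : forall n (s t : 'S_n) (o : oper n),
    oact (t * s)%g o = oact t (oact s o);
  oact_deg : forall n (s : 'S_n) p (o : oper n),
    oact s (gcomp (oper n) p o) = gcomp (oper n) p (oact s o);

  ocomp_linearl : forall n (k : 'I_n -> nat) (a : forall i, oper (k i)),
    linear (fun o : oper n => ocomp o a);
  ocomp_linearr : forall n (k : 'I_n -> nat) (o : oper n)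
    (a : forall i, oper (k i)) (i : 'I_n),
    linear (fun x : oper (k i) => ocomp o (dfwith a x));
  ocomp_deg : forall n (k : 'I_n -> nat) (o : oper n)
    (a : forall i, oper (k i)) (r : int) (q : 'I_n -> int),
    homog r o -> (forall i, homog (q i) (a i)) ->
    homog (r + \sum_(i < n) q i) (ocomp o a);

  ocomp_idl : forall n (o : oper n),
    Tagged oper (ocomp oid (fun _ : 'I_1 => o)) = Tagged oper o;
  ocomp_idr : forall n (o : oper n),
    Tagged oper (ocomp o (fun _ : 'I_n => oid)) = Tagged oper o;
  ocompA : forall n (k : 'I_n -> nat) (l : forall i, 'I_(k i) -> nat)
    (o : oper n) (a : forall i, oper (k i))
    (b : forall i (j : 'I_(k i)), oper (l i j)),
    Tagged oper (ocomp (ocomp o a)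
                   (fun x => b (tagnat.sig1 x) (tagnat.sig2 x))) =
    Tagged oper (ocomp o (fun i => ocomp (a i) (b i)));

  (* (o.s)(a_1, ..., a_n) = o(a_(s^-1 1), ..., a_(s^-1 n)).s(k_1, ..., k_n),
     written for b_j = a_(s^-1 j). *)
  ocomp_actl : forall n (k : 'I_n -> nat) (s : 'S_n) (o : oper n)
    (b : forall j, oper (k j)),
    Tagged oper (ocomp (oact s o) (fun i => b (s i))) =
    Tagged oper (oact (block_perm k s) (ocomp o b));
  ocomp_actr : forall n (k : 'I_n -> nat) (t : forall i, 'S_(k i))
    (o : oper n) (a : forall i, oper (k i)),
    ocomp o (fun i => oact (t i) (a i)) =
    oact (direct_sum_perm t) (ocomp o a) }.
Arguments oact {_ _}.

Record gradedOperadHom (P Q : gradedOperad) := GradedOperadHom {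
  ohom :> forall n, {linear P n -> Q n};
  ohom_deg : forall n p (o : P n),
    ohom n (gcomp (P n) p o) = gcomp (Q n) p (ohom n o);
  ohom_act : forall n (s : 'S_n) (o : P n),
    ohom n (oact s o) = oact s (ohom n o);
  ohom_id : ohom 1%N (oid P) = oid Q;
  ohom_comp : forall n (k : 'I_n -> nat) (o : P n) (a : forall i, P (k i)),
    ohom (\sum_(i < n) k i)%N (ocomp o a) =
    ocomp (ohom n o) (fun i => ohom (k i) (a i)) }.

Record dgOperad := DgOperad {
  dg_operad :> gradedOperad;
  odiff : forall n, {linear dg_operad n -> dg_operad n};
  odiff_deg : forall n p (o : dg_operad n),
    odiff n (gcomp (dg_operad n) p o) =
    gcomp (dg_operad n) (p + 1) (odiff n o);
  odiffK : forall n (o : dg_operad n), odiff n (odiff n o) = 0;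
  odiff_act : forall n (s : 'S_n) (o : dg_operad n),
    odiff n (oact s o) = oact s (odiff n o);
  odiff_comp : forall n (k : 'I_n -> nat) (o : dg_operad n)
    (a : forall i, dg_operad (k i)),
    odiff _ (ocomp o a) =
    ocomp (odiff n o) a +
    \sum_(i < n) ocomp o (dfwith a (odiff (k i) (a i))) }.

Definition odg (O : dgOperad) (n : nat) : dgSpace :=
  DgSpace (@odiff_deg O n) (@odiffK O n).

Record dgOperadHom (P Q : dgOperad) := DgOperadHom {
  dg_ohom :> gradedOperadHom P Q;
  ohom_diff : forall n (o : P n),
    dg_ohom n (odiff P n o) = odiff Q n (dg_ohom n o) }.

(* [O n] is a projective resolution of the trivial F_2[Sigma_n]-module F_2; the
   augmentation [eps] is only relevant in degree 0. *)
Record projective_resolution (O : dgOperad) (n : nat) : Prop := {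
  res_projective : forall p,
    projective (part_symModule p (@oact1 O n) (@oact_mul O n) (@oact_deg O n));
  res_bounded : forall (p : int) (o : O n), 0 < p -> homog p o -> o = 0;
  res_exact : forall (p : int) (o : O n), p < 0 -> homog p o -> odiff O n o = 0 ->
    exists2 o' : O n, homog (p - 1) o' & o = odiff O n o';
  res_augmentation : exists eps : {linear O n -> ('F_2)^o},
    [/\ forall (s : 'S_n) o, eps (oact s o) = eps o,
        exists o, homog 0 o /\ eps o = 1 &
        forall o, homog 0 o ->
          (eps o = 0 <-> exists2 o', homog (-1) o' & o = odiff O n o')] }.

Definition upd (T : Type) n (a : n.-tuple T) (i : 'I_n) (x : T) : n.-tuple T :=
  [tuple if j == i then x else tnth a j | j < n].

Record opAlgebra (O : dgOperad) := OpAlgebra {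
  alg_space :> dgSpace;
  ev : forall n, O n -> n.-tuple alg_space -> alg_space;

  ev_linearl : forall n (a : n.-tuple alg_space), linear (fun o => ev o a);
  ev_linearr : forall n (o : O n) (a : n.-tuple alg_space) (i : 'I_n),
    linear (fun x => ev o (upd a i x));
  ev_deg : forall n (o : O n) (a : n.-tuple alg_space) (r : int)
    (q : 'I_n -> int),
    homog r o -> (forall i, homog (q i) (tnth a i)) ->
    homog (r + \sum_(i < n) q i) (ev o a);
  ev_diff : forall n (o : O n) (a : n.-tuple alg_space),
    diff alg_space (ev o a) =
    ev (odiff O n o) a +
    \sum_(i < n) ev o (upd a i (diff alg_space (tnth a i)));

  ev_id : forall x, ev (oid O) [tuple x] = x;
  ev_comp : forall n (k : 'I_n -> nat) (o : O n) (b : forall i, O (k i))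
    (a : (\sum_(i < n) k i)%N.-tuple alg_space),
    ev (ocomp o b) a =
    ev o [tuple ev (b i) [tuple tnth a (tagnat.Rank i j) | j < k i] | i < n];
  ev_act : forall n (s : 'S_n) (o : O n) (a : n.-tuple alg_space),
    ev (oact s o) a = ev o [tuple tnth a (s^-1%g i) | i < n] }.

Definition s21 : 'S_2 := tperm ord0 ord_max.

(* [tp4 i j] exchanges the i-th and j-th of the four letters 1, 2, 3, 4. *)
Definition tp4 (i j : nat) : 'S_4 := tperm (inord i.-1) (inord j.-1).
Definition s3214 : 'S_4 := tp4 1 3.
Definition s2143 : 'S_4 := (tp4 1 2 * tp4 3 4)%g.
Definition s4321 : 'S_4 := (tp4 1 4 * tp4 2 3)%g.
Definition s3412 : 'S_4 := (tp4 1 3 * tp4 2 4)%g.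

(* (i, j) = (i + j)! / (i! j!) modulo 2. *)
Definition binmod2 (i j : int) : 'F_2 :=
  match i, j with
  | Posz a, Posz b => ('C((a + b)%N, a))%:R
  | _, _ => 0
  end.

Definition posn (z : int) : nat := if z is Posz n then n else 0%N.

(* The elements [u^m_n]_x and alpha_{n,p} are defined in any operad endowed with
   elements [e i] of arity 2; for the free operad E on the e_i they are those of
   E(4), and in general their images under the induced morphism from E. *)
Section LevAC.
Variables (P : gradedOperad) (e : nat -> P 2%N).

Definition ez (i : int) : P 2%N := if i is Posz n then e n else 0.

Fact arity22 : (\sum_(i < 2) 2)%N = 4%N.
Proof. by rewrite sum_nat_const card_ord. Qed.

Definition comp22 (o a b : P 2%N) : P 4%N :=
  ecast n (P n) arity22
    (ocomp o (fun i : 'I_2 => if i == ord0 then a else b)).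

(* [u^m_n]_x, for m > 0.  In the inner sum, the condition on [delta] forces
   0 <= delta <= n + i. *)
Definition ucomp (m : nat) (n x : int) : P 4%N :=
  let ex := oact (s21 ^+ m.-1)%g (ez x) in
  let K := (2 ^ (trunc_log 2 m).+1)%N in
  if n < 0 then 0
  else if n == 0 then comp22 ex (e 0) (e 0)
  else \sum_(i < K)
    \sum_(delta < posn (n + i%:Z + 1) |
          0 <= K%:Z * delta%:Z - i%:Z <= n)
      binmod2 (n - m%:Z + i%:Z) (m%:Z - 1) *:
      (binmod2 i m *:
         comp22 ex (ez (K%:Z * delta%:Z - i%:Z))
                   (ez (n + i%:Z - K%:Z * delta%:Z)) +
       binmod2 (i%:Z - 1) m *:
         comp22 ex (ez (K%:Z * delta%:Z - i%:Z))
                   (oact s21 (ez (n + i%:Z - K%:Z * delta%:Z)))).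

Definition alpha (n p : int) : P 4%N :=
  \sum_(s < posn (n - p + 1)) ucomp s.+1 (s%:Z + p) (n - s%:Z - p) +
  oact s3412
    (\sum_(s < posn (n - p)) ucomp s.+1 (s%:Z + p + 1) (n - s%:Z - p - 1)).

Variable G : nat -> nat -> P 4%N.

Definition Gz (m n : nat) : P 4%N := if (0 < m <= n)%N then G m n else 0.

Definition idp (s : 'S_4) (o : P 4%N) : P 4%N := o + oact s o.

(* d G^m_n for n >= m >= 1; the truncation of m - 2 is harmless, since
   G^0_n = 0. *)
Definition diffG (m n : nat) : P 4%N :=
  let p := (m.-1)./2 in
  (if n == m then idp s2143 (oact s3214 (Gz m.-1 m.-1))
   else idp s2143 (Gz m n.-1)) +
  idp s4321 (Gz (m - 2) n.-1) +
  alpha (n.-1%:Z) (n.-1%:Z - p%:Z) + oact s3214 (alpha (n.-1%:Z) p%:Z).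

End LevAC.

(* [L], with generators [e] and [G], is the operad Lev^AC.  The last two fields
   express that its underlying graded operad is freely generated by the [e i],
   of arity 2, and the [G m n], n >= m >= 1, of arity 4. *)
Record is_levAC (L : dgOperad) (e : nat -> L 2%N) (G : nat -> nat -> L 4%N) :
    Prop := {
  lev_e_deg : forall i : nat, homog (- i%:Z) (e i);
  lev_G_deg : forall m n : nat, (0 < m <= n)%N -> homog (- n%:Z) (G m n);
  lev_e_diff : forall i : nat,
    odiff L 2 (e i) = ez e (i%:Z - 1) + oact s21 (ez e (i%:Z - 1));
  lev_G_diff : forall m n : nat, (0 < m <= n)%N ->
    odiff L 4 (G m n) = diffG e G m n;
  lev_free : forall (P : gradedOperad) (e' : nat -> P 2%N)
    (G' : nat -> nat -> P 4%N),
    (forall i : nat, homog (- i%:Z) (e' i)) ->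
    (forall m n : nat, (0 < m <= n)%N -> homog (- n%:Z) (G' m n)) ->
    exists f : gradedOperadHom L P,
      (forall i, f 2%N (e i) = e' i) /\
      (forall m n, (0 < m <= n)%N -> f 4%N (G m n) = G' m n);
  lev_free_uniq : forall (P : gradedOperad) (f g : gradedOperadHom L P),
    (forall i, f 2%N (e i) = g 2%N (e i)) ->
    (forall m n, (0 < m <= n)%N -> f 4%N (G m n) = g 4%N (G m n)) ->
    forall n (o : L n), f n o = g n o }.

Record ademCartan (O : dgOperad) := AdemCartan {
  ac_res : projective_resolution O 2;
  ac_lev : dgOperad;
  ac_lev_e : nat -> ac_lev 2%N;
  ac_lev_G : nat -> nat -> ac_lev 4%N;
  ac_levP : is_levAC ac_lev_e ac_lev_G;
  ac_hom : dgOperadHom ac_lev O;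
  ac_qis : quasi_iso (V := odg ac_lev 2) (W := odg O 2) (ac_hom 2%N) }.

Definition ac_e (O : dgOperad) (acO : ademCartan O) (i : int) : O 2%N :=
  ez (fun n => ac_hom acO 2%N (ac_lev_e acO n)) i.

(* Binomial coefficients modulo 2; zero unless 0 <= b <= a. *)
Definition binz (a b : int) : 'F_2 :=
  match a, b with
  | Posz m, Posz n => ('C(m, n))%:R
  | _, _ => 0
  end.

Inductive sqTerm :=
  | TSq of int | TZero | TOne | TAdd of sqTerm & sqTerm
  | TMul of sqTerm & sqTerm.

HB.instance Definition _ := gen_eqMixin sqTerm.
HB.instance Definition _ := gen_choiceMixin sqTerm.

(* The right-hand side of the Adem relation; the coefficient vanishes unless
   t - s + 1 <= i <= t / 2. *)
Definition adem_rhs (t s : int) : sqTerm :=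
  \big[TAdd/TZero]_(j < posn ((t %/ 2)%Z - t + s) |
      binz (s - (t - s + 1 + j%:Z) - 1) (t - 2 * (t - s + 1 + j%:Z)) != 0)
    TMul (TSq (s + t - (t - s + 1 + j%:Z))) (TSq (t - s + 1 + j%:Z)).

(* The congruence generated by the axioms of F_2-algebras and by the Adem
   relations. *)
Inductive sqCong : sqTerm -> sqTerm -> Prop :=
  | cong_refl a : sqCong a a
  | cong_sym a b : sqCong a b -> sqCong b a
  | cong_trans a b c : sqCong a b -> sqCong b c -> sqCong a c
  | cong_add a a' b b' :
      sqCong a a' -> sqCong b b' -> sqCong (TAdd a b) (TAdd a' b')
  | cong_mul a a' b b' :
      sqCong a a' -> sqCong b b' -> sqCong (TMul a b) (TMul a' b')
  | cong_addA a b c : sqCong (TAdd a (TAdd b c)) (TAdd (TAdd a b) c)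
  | cong_addC a b : sqCong (TAdd a b) (TAdd b a)
  | cong_add0 a : sqCong (TAdd TZero a) a
  | cong_addxx a : sqCong (TAdd a a) TZero
  | cong_mulA a b c : sqCong (TMul a (TMul b c)) (TMul (TMul a b) c)
  | cong_mul1l a : sqCong (TMul TOne a) a
  | cong_mul1r a : sqCong (TMul a TOne) a
  | cong_mulDl a b c : sqCong (TMul (TAdd a b) c) (TAdd (TMul a c) (TMul b c))
  | cong_mulDr a b c : sqCong (TMul a (TAdd b c)) (TAdd (TMul a b) (TMul a c))
  | cong_adem t s : t < 2 * s ->
      sqCong (TMul (TSq t) (TSq s)) (adem_rhs t s).

Definition sqCongb (a b : sqTerm) : bool := `[< sqCong a b >].

Fact sqCongb_equiv : equiv_class_of sqCongb.
Proof.
split=> [a|a b|b a c]; first by apply/asboolP; apply: cong_refl.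
- by apply/asboolP/asboolP; apply: cong_sym.
- move=> /asboolP ab /asboolP bc; apply/asboolP; exact: cong_trans ab bc.
Qed.
Canonical sqCongb_equiv_rel := EquivRelPack sqCongb_equiv.
Canonical sqCongb_encModRel := defaultEncModRel sqCongb.

Definition steenrod := {eq_quot sqCongb}.
HB.instance Definition _ : EqQuotient sqTerm sqCongb steenrod :=
  EqQuotient.on steenrod.
HB.instance Definition _ := Choice.on steenrod.

Definition sqpi (a : sqTerm) : steenrod := \pi_steenrod a.
Definition sqrepr (x : steenrod) : sqTerm := generic_quotient.repr x.

Fact sqpiK x : sqpi (sqrepr x) = x. Proof. exact: reprK. Qed.
Lemma sqpiP a b : sqpi a = sqpi b <-> sqCong a b.
Proof.
rewrite /sqpi; split=> [/eqP|ab]; first by rewrite piE => /asboolP.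
by apply/eqP; rewrite piE; apply/asboolP.
Qed.
Fact sqreprP a : sqCong (sqrepr (sqpi a)) a.
Proof. by apply/sqpiP; rewrite sqpiK. Qed.

Definition Sq (i : int) : steenrod := sqpi (TSq i).
Definition sq_zero : steenrod := sqpi TZero.
Definition sq_one : steenrod := sqpi TOne.
Definition sq_add (x y : steenrod) := sqpi (TAdd (sqrepr x) (sqrepr y)).
Definition sq_mul (x y : steenrod) := sqpi (TMul (sqrepr x) (sqrepr y)).

Fact sqpi_add a b : sqpi (TAdd a b) = sq_add (sqpi a) (sqpi b).
Proof. by apply/sqpiP/cong_sym/cong_add; apply: sqreprP. Qed.
Fact sqpi_mul a b : sqpi (TMul a b) = sq_mul (sqpi a) (sqpi b).
Proof. by apply/sqpiP/cong_sym/cong_mul; apply: sqreprP. Qed.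

Fact sq_addA : associative sq_add.
Proof.
move=> x y z; rewrite -(sqpiK x) -(sqpiK y) -(sqpiK z) -!sqpi_add.
exact/sqpiP/cong_addA.
Qed.
Fact sq_addC : commutative sq_add.
Proof.
by move=> x y; rewrite -(sqpiK x) -(sqpiK y) -!sqpi_add; apply/sqpiP/cong_addC.
Qed.
Fact sq_add0 : left_id sq_zero sq_add.
Proof. by move=> x; rewrite -(sqpiK x) -sqpi_add; apply/sqpiP/cong_add0. Qed.
Fact sq_addxx : left_inverse sq_zero id sq_add.
Proof. by move=> x; rewrite -(sqpiK x) -sqpi_add; apply/sqpiP/cong_addxx. Qed.
HB.instance Definition _ :=
  GRing.isZmodule.Build steenrod sq_addA sq_addC sq_add0 sq_addxx.

Fact sq_mulA : associative sq_mul.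
Proof.
move=> x y z; rewrite -(sqpiK x) -(sqpiK y) -(sqpiK z) -!sqpi_mul.
exact/sqpiP/cong_mulA.
Qed.
Fact sq_mul1l : left_id sq_one sq_mul.
Proof. by move=> x; rewrite -(sqpiK x) -sqpi_mul; apply/sqpiP/cong_mul1l. Qed.
Fact sq_mul1r : right_id sq_one sq_mul.
Proof. by move=> x; rewrite -(sqpiK x) -sqpi_mul; apply/sqpiP/cong_mul1r. Qed.
Fact sq_mulDl : left_distributive sq_mul sq_add.
Proof.
move=> x y z; rewrite -(sqpiK x) -(sqpiK y) -(sqpiK z).
by rewrite -!(sqpi_add, sqpi_mul); apply/sqpiP/cong_mulDl.
Qed.
Fact sq_mulDr : right_distributive sq_mul sq_add.
Proof.
move=> x y z; rewrite -(sqpiK x) -(sqpiK y) -(sqpiK z).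
by rewrite -!(sqpi_add, sqpi_mul); apply/sqpiP/cong_mulDr.
Qed.

Fixpoint sq_aug (a : sqTerm) : 'F_2 :=
  match a with
  | TSq _ | TZero => 0
  | TOne => 1
  | TAdd a b => sq_aug a + sq_aug b
  | TMul a b => sq_aug a * sq_aug b
  end.

Fact sq_aug_cong a b : sqCong a b -> sq_aug a = sq_aug b.
Proof.
elim=> //= {a b}; try by move=> *; congruence.
- by move=> a b c; rewrite addrA.
- by move=> a b; rewrite addrC.
- by move=> a; rewrite add0r.
- by move=> a; rewrite addrr_pchar2 // pchar_Fp.
- by move=> a b c; rewrite mulrA.
- by move=> a; rewrite mul1r.
- by move=> a; rewrite mulr1.
- by move=> a b c; rewrite mulrDl.
- by move=> a b c; rewrite mulrDr.
- move=> t s _; rewrite mul0r /adem_rhs.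
  by elim/big_rec: _ => //= i a _ <-; rewrite mul0r addr0.
Qed.

Fact sq_one_neq0 : sq_one != sq_zero.
Proof. by apply/eqP => /sqpiP/sq_aug_cong. Qed.
HB.instance Definition _ := GRing.Zmodule_isNzRing.Build steenrod
  sq_mulA sq_mul1l sq_mul1r sq_mulDl sq_mulDr sq_one_neq0.

Definition sq_scale (c : 'F_2) (x : steenrod) : steenrod :=
  if c == 0 then 0 else x.

Fact F2_cases (c : 'F_2) : c = 0 \/ c = 1.
Proof. by case: c => [[|[|[]]] ?] //; [left|right]; apply: val_inj. Qed.
Fact sq_scaleA a b x : sq_scale a (sq_scale b x) = sq_scale (a * b) x.
Proof.
by case: (F2_cases a) => ->; case: (F2_cases b) => ->; rewrite /sq_scale ?mul0r
  ?mul1r /=.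
Qed.
Fact sq_scale1 : left_id 1 sq_scale. Proof. by []. Qed.
Fact sq_scaleDr : right_distributive sq_scale +%R.
Proof. by move=> a x y; rewrite /sq_scale; case: eqP; rewrite ?addr0. Qed.
Fact sq_scaleDl x : {morph sq_scale^~ x : a b / a + b}.
Proof.
move=> a b; case: (F2_cases a) => ->; case: (F2_cases b) => ->;
  rewrite /sq_scale /= ?add0r ?addr0 //=.
by rewrite [RHS](sq_addxx x).
Qed.
HB.instance Definition _ := GRing.Zmodule_isLmodule.Build 'F_2 steenrod
  sq_scaleA sq_scale1 sq_scaleDr sq_scaleDl.
Fact sq_scaleAl (a : 'F_2) (x y : steenrod) : a *: (x * y) = a *: x * y.
Proof. by case: (F2_cases a) => ->; rewrite ?scale0r ?scale1r ?mul0r. Qed.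
HB.instance Definition _ := GRing.Lmodule_isLalgebra.Build 'F_2 steenrod
  sq_scaleAl.
Fact sq_scaleAr (a : 'F_2) (x y : steenrod) : a *: (x * y) = x * (a *: y).
Proof. by case: (F2_cases a) => ->; rewrite ?scale0r ?scale1r ?mulr0. Qed.
HB.instance Definition _ := GRing.Lalgebra_isAlgebra.Build 'F_2 steenrod
  sq_scaleAr.

Lemma Sq_adem (t s : int) : t < 2 * s ->
  Sq t * Sq s = \sum_(i \in [set: int])
    binz (s - i - 1) (t - 2 * i) *: (Sq (s + t - i) * Sq i).
Proof.
move=> ts; transitivity (sqpi (adem_rhs t s)).
  by rewrite -[LHS]sqpi_mul; apply/sqpiP/cong_adem.
set N := posn ((t %/ 2)%Z - t + s); pose f (j : nat) : int := t - s + 1 + j%:Z.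
have f_inj : injective f by move=> x y /addrI [].
rewrite (fsbigE (map f (iota 0 N))) //=; first last.
- move=> i _ /negP ni; suff -> : binz (s - i - 1) (t - 2 * i) = 0 by rewrite scale0r.
  apply/eqP/negPn/negP => nz; apply: ni.
  suff /andP[i1 i2] : (t - s + 1 <= i <= (t %/ 2)%Z).
    apply/mapP; exists (absz (i - (t - s + 1))%R); last by rewrite /f; lia.
    by rewrite mem_iota /N /posn; case E: (_ + s) => /=; lia.
  move: nz; rewrite /binz; case E1: (s - i - 1) => [a|a];
    case E2: (t - 2 * i) => [b|b]; rewrite /= ?eqxx //.
  have [ab|ab] := ltnP a b; first by rewrite bin_small // eqxx.
  by move=> _; lia.
- by rewrite (map_inj_uniq f_inj) iota_uniq.
have -> : iota 0 N = index_iota 0 N by rewrite /index_iota subn0.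
rewrite big_map big_mkord /adem_rhs -/N.
have -> : sqpi (\big[TAdd/TZero]_(j < N | binz (s - f j - 1) (t - 2 * f j) != 0)
    TMul (TSq (s + t - f j)) (TSq (f j))) =
  \sum_(j < N | binz (s - f j - 1) (t - 2 * f j) != 0) (Sq (s + t - f j) * Sq (f j)).
  elim/big_rec2: _ => // j y x _ <-.
  by rewrite [LHS]sqpi_add [sqpi (TMul _ _)]sqpi_mul.
rewrite big_mkcond; apply: eq_big => [j|j _]; first by rewrite in_setT.
by set c := binz _ _; case: (F2_cases c) => ->; rewrite ?scale0r ?scale1r.
Qed.

(* The part of degree p of the algebra: the span of the monomials
   Sq^i_1 ... Sq^i_k with i_1 + ... + i_k = p. *)
Inductive steenrod_homog : int -> steenrod -> Prop :=
  | steenrod_homog0 p : steenrod_homog p 0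
  | steenrod_homogD p x y :
      steenrod_homog p x -> steenrod_homog p y -> steenrod_homog p (x + y)
  | steenrod_homog1 : steenrod_homog 0 1
  | steenrod_homogSq i : steenrod_homog i (Sq i)
  | steenrod_homogM p q x y : steenrod_homog p x -> steenrod_homog q y ->
      steenrod_homog (p + q) (x * y).

Record graded_steenrod_module (V : gradedSpace) (act : steenrod -> V -> V) :
    Prop := {
  act_linearl : forall x, linear (fun b => act b x);
  act_linearr : forall b, linear (act b);
  act_1 : forall x, act 1 x = x;
  act_M : forall b c x, act (b * c) x = act b (act c x);
  act_homog : forall p q b x, steenrod_homog p b -> homog q x ->
    homog (p + q) (act b x) }.

Record graded_level_algebra (V : gradedSpace) (mul : V -> V -> V) : Prop := {
  mul_linearl : forall y, linear (fun x => mul x y);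
  mul_linearr : forall x, linear (mul x);
  mul_homog : forall p q x y, homog p x -> homog q y -> homog (p + q) (mul x y);
  mul_comm : forall x y, mul x y = mul y x;
  mul_level : forall a b c d, mul (mul a b) (mul c d) = mul (mul a c) (mul b d) }.

Record unstable_level_algebra (V : gradedSpace) (mul : V -> V -> V)
    (act : steenrod -> V -> V) : Prop := {
  ula_level : graded_level_algebra mul;
  ula_module : graded_steenrod_module act;
  ula_instable : forall (n p : int) x, homog p x -> p < n -> act (Sq n) x = 0;
  ula_square : forall (p : int) x, homog p x -> act (Sq p) x = mul x x;
  ula_cartan : forall (s p q : int) x y, homog p x -> homog q y ->
    act (Sq s) (mul x y) =
    \sum_(t \in [set: int]) mul (act (Sq t) x) (act (Sq (s - t)) y) }.

(* Main.v *)
Require Import Defs.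
From HB Require Import structures.
From mathcomp Require Import all_boot all_order all_algebra all_fingroup.
From mathcomp Require Import zify.
From mathcomp Require Import boolp classical_sets fsbigop.

(* Everything is read off from the coboundaries dG^m_n(a_1, ..., a_4), a_i
   cocycles.  dG^1_1 gives the level relation.  On (a, a, b, b) the G-terms of
   dG^1_(N+1) cancel; one alpha-term is the right-hand side of the Cartan
   formula and the other one differs from e_N(e_0(a, b), e_0(a, b)) by an
   explicit coboundary.  On (a, a, a, a) the G-terms of dG^(2p+1)_(N+1) cancel
   as well, and since the coefficients of u^m_n are symmetric, only the middle
   terms of the alpha's survive.  The resulting relation is the symmetry of the
   coefficients of x^p y^(N-p) and x^(N-p) y^p in
     sum_j (x (x + y))^j y^(N-2j) Sq^(2n-N+j) Sq^(n-j) [a],   n = |a|,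
   that is, the form of the Adem relations found by Bullett and Macdonald.  The
   usual relation for Sq^t Sq^(n-k) is the residue of this symmetry, at y = 1,
   against (x (x + 1))^(-k-1) dx; this is Vandermonde's identity modulo 2. *)

Set Implicit Arguments.
Unset Strict Implicit.
Unset Printing Implicit Defensive.

Import Order.TTheory GRing.Theory Num.Theory.
Local Open Scope ring_scope.

(** * Vector spaces over F_2 and reindexing of sums *)

Lemma addvv (V : lmodType 'F_2) (x : V) : x + x = 0.
Proof. by rewrite -mulr2n -scaler_nat (_ : 2%:R = 0) ?scale0r //;
  apply: val_inj. Qed.

Lemma natF2 n : n%:R = (odd n)%:R :> 'F_2.
Proof.
elim: n => [//|n IH]; rewrite oddS mulrS IH.
by case: (odd n); apply: val_inj.
Qed.

Lemma scale_natF2 (V : lmodType 'F_2) n (x : V) :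
  n%:R *: x = if odd n then x else 0.
Proof. by rewrite natF2; case: (odd n); rewrite ?scale1r ?scale0r. Qed.

Lemma addvKv (V : lmodType 'F_2) (x y : V) : x + (x + y) = y.
Proof. by rewrite addrA addvv add0r. Qed.

Lemma oppv (V : lmodType 'F_2) (x : V) : - x = x.
Proof. by apply: (addrI x); rewrite subrr addvv. Qed.

Lemma F2_additive_linear (U V : lmodType 'F_2) (f : U -> V) :
  {morph f : x y / x + y} -> linear f.
Proof.
move=> fD c x y; case: (F2_cases c) => ->; last by rewrite !scale1r fD.
by rewrite !scale0r !add0r.
Qed.

Lemma sum_shift (V : nmodType) p M (F : nat -> V) : (p <= M)%N ->
  \sum_(s < M - p) F (s + p)%N = \sum_(n < M) if (p <= n)%N then F n else 0.
Proof.
move=> le_pM; rewrite -[in RHS](big_mkord xpredT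
  (fun n => if (p <= n)%N then F n else 0)).
rewrite (@big_cat_nat _ _ _ p) //= big_nat [X in _ = X + _]big1 =>
  [|n /andP[_ lt_np]]; last first.
  by rewrite leqNgt lt_np.
rewrite add0r -[X in index_iota X]add0n big_addn big_mkord;
  apply: eq_bigr => s _.
by rewrite leq_addl.
Qed.

Lemma sum_even (V : nmodType) M (F : nat -> V) :
  \sum_(n < M.*2) (if odd n then 0 else F n) = \sum_(j < M) F j.*2.
Proof.
elim: M => [|M IH]; first by rewrite !big_ord0.
by rewrite doubleS !big_ord_recr /= IH odd_double /= addr0.
Qed.

Lemma fsum_seq (T : choiceType) (V : nmodType) (s : seq T) (f : T -> V) :
  uniq s -> (forall p, p \notin s -> f p = 0) ->
  \sum_(p \in [set: T]) f p = \sum_(p <- s) f p.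
Proof.
move=> us fs; rewrite (fsbigE s) //= => [|p _]; last exact: fs.
by apply: eq_bigl => p; rewrite in_setT.
Qed.

(** * Binomial coefficients modulo 2 *)

Section BinomialParity.
Local Open Scope nat_scope.

(** The product of q and C(2^r, q) is a multiple of 2^r; were the binomial odd, 2^r would divide
    q. *)
Lemma odd_bin_expn2 r q : 0 < q < 2 ^ r -> odd 'C(2 ^ r, q) = false.
Proof.
case: q => // q lt_q; apply/negP => odd_bin; have := mul_bin_diag (2 ^ r) q.
move/(congr1 (dvdn (2 ^ r))); rewrite dvdn_mulr // => /esym.
rewrite Gauss_dvdl; last by rewrite coprimeXl // coprime2n.
by move/dvdn_leq => /(_ isT); rewrite leqNgt => /negP; apply.
Qed.

(** This is the congruence of (1 + x)^(2^r) to 1 modulo 2 and x^(2^r), carried along Pascal's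
    rule. *)
Lemma odd_bin_addexpn2 r a q : q < 2 ^ r -> odd 'C(a + 2 ^ r, q) = odd 'C(a, q).
Proof.
elim: a q => [|a IH] [|q] lt_q; rewrite ?bin0 //.
  by rewrite odd_bin_expn2 // bin0n.
by rewrite addSn !binS !oddD !IH // ltnW.
Qed.

Lemma odd_bin_mod r a b q :
  q < 2 ^ r -> a = b %[mod 2 ^ r] -> odd 'C(a, q) = odd 'C(b, q).
Proof.
have red k : q < 2 ^ r -> odd 'C(k, q) = odd 'C(k %% 2 ^ r, q).
  move=> lt_q; rewrite {1}(divn_eq k (2 ^ r)); elim: (k %/ _) => [//|l IH].
  by rewrite mulSn -addnA addnC odd_bin_addexpn2.
by move=> lt_q ab; rewrite red // ab -red.
Qed.

(** Consecutive entries of row 2^r - 1 add up to an even entry of row 2^r, so the oddness of the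
    first one propagates. *)
Lemma odd_bin_expn2_pred r q : q < 2 ^ r -> odd 'C((2 ^ r).-1, q).
Proof.
elim: q => [|q IH] lt_q; rewrite ?bin0 //.
have := odd_bin_expn2 (q := q.+1) lt_q; rewrite -{1}(prednK (expn_gt0 2 r)).
by rewrite binS oddD IH 1?ltnW // addbT => /negbFE.
Qed.

(** Up to sign C(i + q, q) is C(- i - 1, q), and modulo 2 the upper index may be shifted by 2^r. *)
Lemma odd_bin_reflect r i q : i < 2 ^ r -> q < 2 ^ r ->
  odd 'C(i + q, q) = odd 'C((2 ^ r).-1 - i, q).
Proof.
elim: q i => [|q IHq] i lt_i lt_q; first by rewrite !bin0.
elim: i lt_i => [|i IHi] lt_i.
  by rewrite subn0 odd_bin_expn2_pred // binn.
rewrite addSn binS oddD (IHi (ltnW lt_i)) addnS -addSn (IHq _ lt_i (ltnW lt_q)).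
have -> : (2 ^ r).-1 - i = ((2 ^ r).-1 - i.+1).+1 by lia.
by rewrite binS oddD addbK.
Qed.

(* The binomial coefficient [C(j - 1, q)] modulo 2; [C(-1, q)] is odd. *)
Definition binp (j q : nat) := if j is j'.+1 then 'C(j', q) else 1.

(** Upper negation, followed by replacing - i - 1 with j - 1, to which it is congruent modulo
    2^r. *)
Lemma odd_bin_oppmod r i j q : i < 2 ^ r -> q < 2 ^ r -> 2 ^ r %| i + j ->
  odd 'C(i + q, q) = odd (binp j q).
Proof.
move=> lt_i lt_q; case: j => [|j] /= dvd_ij.
  move: dvd_ij; rewrite addn0 /dvdn modn_small // => /eqP->.
  by rewrite binn.
rewrite (odd_bin_reflect (r := r)) //; apply: (odd_bin_mod (r := r)) => //.
apply/eqP; rewrite -(eqn_modDr i.+1).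
have -> : (2 ^ r).-1 - i + i.+1 = 2 ^ r by lia.
by rewrite modnn eq_sym addnS -addSn addnC.
Qed.

(** The upper index is congruent to n - j - 1; for j = n this is - 1, where all binomials are
    odd. *)
Lemma odd_bin_submod r n i j q : j <= n -> q < 2 ^ r -> 2 ^ r %| i + j ->
  0 < n -> odd 'C(n.-1 + i, q) = odd (binp (n - j) q).
Proof.
move=> le_jn lt_q dvd_ij n0; case E: (n - j) => [|k] /=; last first.
  apply: (odd_bin_mod (r := r)) => //.
  have -> : n.-1 + i = k + (i + j) by lia.
  by rewrite -modnDmr (eqP dvd_ij) addn0.
rewrite -[RHS](odd_bin_expn2_pred lt_q); apply: (odd_bin_mod (r := r)) => //.
apply/eqP; rewrite -(eqn_modDr 1); have -> : n.-1 + i + 1 = i + j by lia.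
by rewrite addn1 prednK ?expn_gt0 // (eqP dvd_ij) modnn.
Qed.

Lemma odd_bin_pred_dvdn r i q : q < 2 ^ r -> 2 ^ r %| i.+1 -> odd 'C(i, q).
Proof.
move=> lt_q dvd_i; rewrite (odd_bin_mod (r := r) (b := (2 ^ r).-1))
  ?odd_bin_expn2_pred //.
apply/eqP; rewrite -(eqn_modDr 1) !addn1 prednK ?expn_gt0 // modnn.
exact: dvd_i.
Qed.

Lemma odd_binp j q :
  odd 'C(j, q) = odd (binp j q) (+) ((0 < q) && odd (binp j q.-1)).
Proof.
case: j q => [|j] [|q] //=; first by rewrite !bin0.
by rewrite binS oddD.
Qed.

(* The coefficient of [x^p] in [(x (1 + x))^j]. *)
Definition bindouble p j := if (p <= j.*2)%N then 'C(j, j.*2 - p) else 0%N.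

Lemma odd_bin_double q : (0 < q)%N -> odd 'C(q + q, q) = false.
Proof.
case: q => // q _; rewrite addSn binS oddD addnS -addSn
  -(@bin_sub (q.+1 + q) q) ?leq_addl //.
by rewrite addnK addbb.
Qed.

(** Both sides are the coefficient of x^j0 in (1 + x)^M (x (1 + x))^j = x^j (1 + x)^(M + j). *)
Lemma sum_bindouble M j0 j :
  (\sum_(p < j0.+1) 'C(M, j0 - p) * bindouble p j)%N =
  (if j <= j0 then 'C(M + j, j0 - j) else 0)%N.
Proof.
have bd p : bindouble p j = if (j <= p)%N then 'C(j, p - j) else 0%N.
  rewrite /bindouble; case: (leqP p j.*2) => le1; case: (leqP j p) => le2 //.
  - by rewrite -bin_sub; [congr 'C(_, _); lia | lia].
  - by rewrite bin_small //; lia.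
  - by rewrite bin_small //; lia.
under eq_bigr do rewrite bd; case: (leqP j j0) => le_j; last first.
  by apply: big1 => p _; case: ifP; rewrite ?muln0 //; have := ltn_ord p; lia.
rewrite -(big_mkord xpredT (fun p => 'C(M, j0 - p) * if (j <= p)%N then
  'C(j, p - j) else 0)%N).
rewrite (@big_cat_nat _ _ _ j) //=; last exact: leqW.
rewrite big_nat [X in (X + _)%N]big1 => [|p /andP[_ lt_p]];
  last by rewrite leqNgt lt_p muln0.
rewrite add0n -[X in index_iota X]add0n big_addn big_mkord addnC
  -binomial.Vandermonde subSn //.
apply: eq_bigr => i _; rewrite leq_addl addnK mulnC.
by congr (_ * 'C(_, _))%N; lia.
Qed.

(** Reversing coefficients with respect to degree N turns (x (1 + x))^j into x^(N - 2j) (1 + x)^j;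
    both sides are the coefficient of x^j0 in its product with (1 + x)^M. *)
Lemma sum_bindouble_opp M N j0 j : (j.*2 <= N)%N -> (j0 <= N)%N ->
  (\sum_(p < j0.+1) 'C(M, j0 - p) * bindouble (N - p) j)%N =
  (if N <= j.*2 + j0 then 'C(M + j, j.*2 + j0 - N) else 0)%N.
Proof.
move=> le_jN le_j0N; rewrite (reindex_inj rev_ord_inj) /=.
have E (q : 'I_j0.+1) : ('C(M, j0 - (j0.+1 - q.+1)) * bindouble
  (N - (j0.+1 - q.+1)) j =
    if q + N <= j.*2 + j0 then 'C(M, q) * 'C(j, j.*2 + j0 - N - q) else 0)%N.
  have := ltn_ord q => lt_q.
  rewrite subSS subKn // /bindouble.
  have -> : (N - (j0 - q) <= j.*2 = (q + N <= j.*2 + j0))%N by lia.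
  by case: ifP => le2; rewrite ?muln0 //; congr (_ * 'C(_, _))%N; lia.
rewrite (eq_bigr _ (fun q _ => E q)) => {E}.
case: ifP => le2; last by apply: big1 => q _; case: ifP => //; lia.
set T := (_ + _ - N)%N.
rewrite -binomial.Vandermonde (big_ord_widen j0.+1
  (fun q => 'C(M, q) * 'C(j, T - q))%N); last by lia.
rewrite [RHS]big_mkcond; apply: eq_bigr => q _.
by rewrite /T; case: ifP; case: ifP => //; lia.
Qed.

End BinomialParity.

Lemma binmod2E a b : binmod2 a%:Z b%:Z = ('C(a + b, b))%:R.
Proof. by rewrite /binmod2 -bin_sub ?leq_addr // addKn. Qed.

(* In the formula of [u^m_n] the term [e_j (x) e_(n-j)] occurs for the only
   index [i < K] congruent to [- j]. *)
Definition oppmod (K j : nat) := ((K - j %% K) %% K)%N.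

Lemma ltn_oppmod K j : (0 < K)%N -> (oppmod K j < K)%N.
Proof. exact: ltn_pmod. Qed.

Lemma dvdn_oppmod K j : (0 < K)%N -> (K %| oppmod K j + j)%N.
Proof.
move=> K0; rewrite /dvdn /oppmod modnDml -modnDmr subnK ?modnn //.
exact/ltnW/ltn_pmod.
Qed.

Lemma oppmod_unique K i j : (0 < K)%N -> (i < K)%N -> (K %| i + j)%N ->
  i = oppmod K j.
Proof.
move=> K0 lt_i /eqP dvd_i; have /eqP dvd_o := dvdn_oppmod j K0.
have /eqP : (i + j = oppmod K j + j %[mod K])%N by rewrite dvd_i dvd_o.
by rewrite eqn_modDr !modn_small ?ltn_oppmod // => /eqP.
Qed.

(** Each j <= n determines i < K by K | i + j, and d is then the quotient: the pairs (i, d) are in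
    bijection with the j. *)
Lemma sum_oppmod (V : zmodType) (F : nat -> nat -> V) K n : (0 < K)%N ->
  \sum_(i < K) \sum_(d < n + i + 1 | (i <= K * d <= n + i)%N)
    F i (K * d - i)%N =
  \sum_(j < n.+1) F (oppmod K j) j.
Proof.
move=> K0; transitivity (\sum_(i < K) \sum_(d < n + i + 1)
    \sum_(j < n.+1 | (i + j == K * d)%N) F i j).
  apply: eq_bigr => i _; rewrite [LHS]big_mkcond; apply: eq_bigr => d _.
  case: ifPn => [/andP[le1 le2]|ncond].
    rewrite (big_pred1 (inord (K * d - i))) /= => [|j].
      by rewrite inordK //; lia.
    by rewrite /= -val_eqE /= inordK; lia.
  by rewrite big_pred0 // => j; apply/negbTE; have := ltn_ord j; lia.
under eq_bigr do rewrite (exchange_big_dep xpredT) //=; rewrite exchange_big.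
apply: eq_bigr => j _ /=.
rewrite (bigD1 (Ordinal (ltn_oppmod j K0))) //= [X in _ + X]big1 ?addr0.
  have /divnK E := dvdn_oppmod j K0.
  have lt_d : ((oppmod K j + j) %/ K < n + oppmod K j + 1)%N.
    by have := leq_div (oppmod K j + j) K; have := ltn_ord j; lia.
  rewrite (big_pred1 (Ordinal lt_d)) // => d.
  by rewrite /= -val_eqE /= -{1}E mulnC eqn_pmul2l // eq_sym.
move=> i ne_i; rewrite big_pred0 // => d; apply/negP => /eqP E.
case/negP: ne_i; rewrite -val_eqE /=; apply/eqP/oppmod_unique => //.
by rewrite E dvdn_mulr.
Qed.

(** * Evaluation on an algebra *)

Section Restriction.
Variables (P Q : dgOperad) (f : dgOperadHom P Q) (A : opAlgebra Q).

Definition restrict_ev n (o : P n) (a : n.-tuple A) : A := ev (f n o) a.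

Fact restrict_linearl n (a : n.-tuple A) : linear (fun o => restrict_ev o a).
Proof. by move=> c x y; rewrite /restrict_ev linearP ev_linearl. Qed.

Fact restrict_deg n (o : P n) (a : n.-tuple A) (r : int) (q : 'I_n -> int) :
  homog r o -> (forall i, homog (q i) (tnth a i)) ->
  homog (r + \sum_(i < n) q i) (restrict_ev o a).
Proof. by move=> ro; apply: ev_deg; rewrite /homog -ohom_deg ro. Qed.

Fact restrict_diff n (o : P n) (a : n.-tuple A) :
  diff A (restrict_ev o a) = restrict_ev (odiff P n o) a +
    \sum_(i < n) restrict_ev o (upd a i (diff A (tnth a i))).
Proof. by rewrite /restrict_ev ohom_diff ev_diff. Qed.

Fact restrict_id x : restrict_ev (oid P) [tuple x] = x.
Proof. by rewrite /restrict_ev ohom_id ev_id. Qed.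

Fact restrict_comp n (k : 'I_n -> nat) (o : P n) (b : forall i, P (k i))
    (a : (\sum_(i < n) k i)%N.-tuple A) :
  restrict_ev (ocomp o b) a = restrict_ev o
    [tuple restrict_ev (b i) [tuple tnth a (tagnat.Rank i j) | j < k i]
      | i < n].
Proof. by rewrite /restrict_ev ohom_comp ev_comp. Qed.

Fact restrict_act n (s : 'S_n) (o : P n) (a : n.-tuple A) :
  restrict_ev (oact s o) a = restrict_ev o [tuple tnth a (s^-1%g i) | i < n].
Proof. by rewrite /restrict_ev ohom_act ev_act. Qed.

(** Pulling an algebra back to Lev^AC makes it possible to compute with the generators themselves,
    whose differentials are prescribed. *)
Definition restrict_alg : opAlgebra P :=
  OpAlgebra restrict_linearl (fun n o => ev_linearr (f n o)) restrict_deg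
    restrict_diff restrict_id restrict_comp restrict_act.

End Restriction.

Section Evaluation.
Variables (L : dgOperad) (A : opAlgebra L).
Implicit Types (a b c d : A).

Definition ev2 a b (o : L 2%N) := ev o [tuple a; b].
Definition ev4 a b c d (o : L 4%N) := ev o [tuple a; b; c; d].

Lemma ev2_linear a b : linear (ev2 a b).
Proof. exact: ev_linearl. Qed.
HB.instance Definition _ a b :=
  GRing.isLinear.Build 'F_2 (L 2%N) A _ (ev2 a b) (ev2_linear a b).

Lemma ev4_linear a b c d : linear (ev4 a b c d).
Proof. exact: ev_linearl. Qed.
HB.instance Definition _ a b c d :=
  GRing.isLinear.Build 'F_2 (L 4%N) A _ (ev4 a b c d) (ev4_linear a b c d).

Lemma ev2_linearl o b : linear (fun a => ev2 a b o).
Proof.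
move=> c x y; have := ev_linearr o [tuple x; b] ord0 c x y.
by congr (ev o _ = _ *: ev o _ + ev o _); apply: val_inj;
  rewrite /= !enum_ordSl enum_ord0.
Qed.

Lemma ev2_linearr o a : linear (fun b => ev2 a b o).
Proof.
move=> c x y; have := ev_linearr o [tuple a; x] ord_max c x y.
by congr (ev o _ = _ *: ev o _ + ev o _); apply: val_inj;
  rewrite /= !enum_ordSl enum_ord0.
Qed.

Lemma ev2_swap o a b : ev2 a b (oact s21 o) = ev2 b a o.
Proof.
rewrite /ev2 ev_act; congr ev; apply: eq_from_tnth => i.
rewrite tnth_mktuple /s21 tpermV.
by case: i => [[|[|//]] ?]; rewrite permE /=.
Qed.

Lemma ev2_swapX o k a b :
  ev2 a b (oact (s21 ^+ k)%g o) = if odd k then ev2 b a o else ev2 a b o.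
Proof.
have -> : (s21 ^+ k)%g = if odd k then s21 else 1%g.
  by elim: k => //= k IH; rewrite expgS IH; case: (odd k);
    rewrite /= ?mulg1 ?tperm2.
by case: (odd k); rewrite ?ev2_swap ?oact1.
Qed.

Lemma ev_ecast m n (E : m = n) (o : L m) (t : n.-tuple A) :
  ev (ecast i (L i) E o) t = ev o (tcast (esym E) t).
Proof. by case: n / E t => t; rewrite tcast_id. Qed.

Lemma ev_comp22 o x y a b c d :
  ev4 a b c d (comp22 o x y) = ev2 (ev2 a b x) (ev2 c d y) o.
Proof.
rewrite /ev4 /comp22 ev_ecast ev_comp; congr ev.
apply: eq_from_tnth => i; rewrite tnth_mktuple.
case: i => [[|[|i]] lt_i] //; rewrite (tnth_nth 0) /=; congr ev;
  apply: eq_from_tnth => j; rewrite tnth_mktuple !(tnth_nth 0) val_tcast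
    tagnat.RankEsum.
  by rewrite big_pred0 ?add0n //; case: j => [[|[|j]] lt_j].
rewrite (big_pred1 ord0); last by case=> [[|[|k]] lt_k].
by case: j => [[|[|j]] lt_j].
Qed.

Lemma ev4_diff o a b c d : diff A a = 0 -> diff A b = 0 -> diff A c = 0 ->
  diff A d = 0 -> diff A (ev4 a b c d o) = ev4 a b c d (odiff L 4 o).
Proof.
move=> a0 b0 c0 d0; rewrite /ev4 ev_diff big1 ?addr0 // => i _.
have -> : diff A (tnth [tuple a; b; c; d] i) = 0.
  by case: i => [[|[|[|[|i]]]] lt_i] //; rewrite (tnth_nth 0).
(* Multilinearity at [1 *: 0 + 0] shows that a value X with a zero entry satisfies X = X + X. *)
have /(_ 1 0 0) := ev_linearr o [tuple a; b; c; d] i.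
by rewrite !scale1r addr0 -[LHS]add0r => /addIr <-.
Qed.

(** Steenrod's cup-i product, extended by zero to i < 0. *)
Definition cup (e : nat -> L 2%N) (i : int) a b : A := ev2 a b (ez e i).

Section Cup.
Variable e : nat -> L 2%N.
Hypothesis e_deg : forall i : nat, homog (- i%:Z) (e i).
Hypothesis e_diff : forall i : nat,
  odiff L 2 (e i) = ez e (i%:Z - 1) + oact s21 (ez e (i%:Z - 1)).

Lemma cup_lt0 i a b : i < 0 -> cup e i a b = 0.
Proof. by case: i => // i _; rewrite /cup linear0. Qed.

Lemma cup_linearl i b : linear (fun a => cup e i a b).
Proof. exact: ev2_linearl. Qed.

Lemma cup_linearr i a : linear (cup e i a).
Proof. exact: ev2_linearr. Qed.

Lemma cup_homog i p q a b :
  homog p a -> homog q b -> homog (p + q - i) (cup e i a b).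
Proof.
move=> pa qb; have ei : homog (- i) (ez e i).
  by case: i => [i|i]; [exact: e_deg | rewrite /homog linear0].
have := ev_deg (a := [tuple a; b]) (q := fun j => if j == ord0 then p else q)
  ei.
rewrite big_ord_recl big_ord1 /= addrC; apply.
by case=> [[|[|j]] lt_j].
Qed.

(** Steenrod's coboundary formula; the first two terms come from d(e_i), the others from the
    derivation rule. *)
Lemma cup_diff i a b : diff A (cup e i a b) =
  cup e (i - 1) a b + cup e (i - 1) b a +
  (cup e i (diff A a) b + cup e i a (diff A b)).
Proof.
rewrite /cup {1}/ev2 ev_diff big_ord_recl big_ord1; congr (_ + (_ + _)).
- rewrite -[LHS]/(ev2 a b _); case: i => [i|i] /=.
    by rewrite e_diff linearD /= ev2_swap.
  by rewrite !linear0 ?addr0.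
- by congr ev; apply: val_inj; rewrite /= !enum_ordSl enum_ord0.
- by congr ev; apply: val_inj; rewrite /= !enum_ordSl enum_ord0.
Qed.

End Cup.
End Evaluation.

(** * Values of the elements u and alpha on four arguments *)

Section Composite.
Variables (L : dgOperad) (A : opAlgebra L) (e : nat -> L 2%N).
Implicit Types a b c d : A.

Lemma ev4_comp22 m x o o' a b c d :
  ev4 a b c d (comp22 (oact (s21 ^+ m)%g (ez e x)) o o') =
  if odd m then cup e x (ev2 c d o') (ev2 a b o)
  else cup e x (ev2 a b o) (ev2 c d o').
Proof. by rewrite ev_comp22 ev2_swapX. Qed.

Lemma ev4_ucomp0 m x a b c d : ev4 a b c d (ucomp e m 0 x) =
  if odd m.-1 then cup e x (cup e 0 c d) (cup e 0 a b)
  else cup e x (cup e 0 a b) (cup e 0 c d).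
Proof. by rewrite /ucomp /= ev4_comp22. Qed.

(** The double sum is regrouped by the index j of the first inner factor, using [sum_oppmod], and
    the coefficients become binomials of natural numbers. *)
Lemma ev4_ucomp m n x a b c d : (0 < m)%N -> (0 < n)%N ->
  ev4 a b c d (ucomp e m n%:Z x) =
  \sum_(j < n.+1) let i := oppmod (2 ^ (trunc_log 2 m).+1) j in
    ('C(n.-1 + i, m.-1))%:R *:
    (('C(i + m, m))%:R *:
       (if odd m.-1 then cup e x (cup e (n - j)%N c d) (cup e j a b)
        else cup e x (cup e j a b) (cup e (n - j)%N c d)) +
     ('C((i + m).-1, m))%:R *:
       (if odd m.-1 then cup e x (cup e (n - j)%N d c) (cup e j a b)
        else cup e x (cup e j a b) (cup e (n - j)%N d c))).
Proof.
move=> m0 n0; rewrite /ucomp; set K := (2 ^ _)%N.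
have K0 : (0 < K)%N by rewrite expn_gt0.
pose F i j : A := ('C(n.-1 + i, m.-1))%:R *:
    (('C(i + m, m))%:R *:
       (if odd m.-1 then cup e x (cup e (n - j)%N c d) (cup e j a b)
        else cup e x (cup e j a b) (cup e (n - j)%N c d)) +
     ('C((i + m).-1, m))%:R *:
       (if odd m.-1 then cup e x (cup e (n - j)%N d c) (cup e j a b)
        else cup e x (cup e j a b) (cup e (n - j)%N d c))).
rewrite -[RHS](sum_oppmod F) //.
have [-> ->] : (n%:Z < 0) = false /\ (n%:Z == 0) = false by lia.
rewrite linear_sum; apply: eq_bigr => i _.
rewrite linear_sum.
have -> : posn (n%:Z + i%:Z + 1) = (n + i + 1)%N by [].
apply: eq_big => [k|k /andP[le1 le2]]; first by lia.
rewrite linearZ /= linearD /= !linearZ /= !ev4_comp22 ev2_swap.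
have -> : binmod2 (n%:Z - m%:Z + i%:Z) (m%:Z - 1) = ('C(n.-1 + i, m.-1))%:R.
  have -> : m%:Z - 1 = m.-1%:Z by lia.
  (* For n - m + i < 0 both sides vanish, the right one because n - 1 + i < m - 1. *)
  case E: (n%:Z - m%:Z + i%:Z) => [l|l]; last by rewrite bin_small //; lia.
  by rewrite binmod2E; congr ('C(_, _))%:R; lia.
have -> : binmod2 (i%:Z - 1) m = ('C((i + m).-1, m))%:R.
  case E: (i%:Z - 1) => [l|l]; last by rewrite bin_small //; lia.
  by rewrite binmod2E; congr ('C(_, _))%:R; lia.
rewrite -[('C(i + m, i))%:R]/(binmod2 i m) binmod2E.
have -> : K%:Z * k%:Z - i%:Z = (K * k - i)%N%:Z by lia.
have -> : n%:Z + i%:Z - K%:Z * k%:Z = (n - (K * k - i))%N%:Z by lia.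
by [].
Qed.

Lemma ev4_tp4 i j a b c d (o : L 4%N) : (0 < i <= 4)%N -> (0 < j <= 4)%N ->
  ev4 a b c d (oact (tp4 i j) o) =
  let t k := [:: a; b; c; d]`_(if k == i.-1 then j.-1 else if k == j.-1 then
    i.-1 else k) in
  ev4 (t 0%N) (t 1%N) (t 2%N) (t 3%N) o.
Proof.
move=> i4 j4; rewrite /ev4 ev_act; congr ev; apply: eq_from_tnth => k.
rewrite tnth_mktuple /tp4 tpermV permE /= !(tnth_nth 0) /= -!val_eqE /=.
rewrite !inordK; [|lia|lia].
rewrite !(fun_if (@nat_of_ord 4)) !inordK; [|lia|lia].
by case: k => [[|[|[|[|k]]]] lt_k].
Qed.

Lemma ev4_s3214 (o : L 4%N) a b c d : ev4 a b c d (oact s3214 o) = ev4 c b a d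
  o.
Proof. by rewrite ev4_tp4. Qed.

Lemma ev4_s3412 (o : L 4%N) a b c d : ev4 a b c d (oact s3412 o) = ev4 c d a b
  o.
Proof. by rewrite oact_mul ev4_tp4 //= ev4_tp4. Qed.

Lemma ev4_s2143 (o : L 4%N) a b c d : ev4 a b c d (oact s2143 o) = ev4 b a d c
  o.
Proof. by rewrite oact_mul ev4_tp4 //= ev4_tp4. Qed.

Lemma ev4_s4321 (o : L 4%N) a b c d : ev4 a b c d (oact s4321 o) = ev4 d c b a
  o.
Proof. by rewrite oact_mul ev4_tp4 //= ev4_tp4. Qed.

Lemma ev4_alpha N p a b c d : (p <= N)%N ->
  ev4 a b c d (alpha e N p) =
  \sum_(s < (N - p).+1) ev4 a b c d (ucomp e s.+1 (s + p)%N (N - p - s)%N) +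
  \sum_(s < (N - p)%N) ev4 c d a b (ucomp e s.+1 (s + p).+1 (N - p - s.+1)%N).
Proof.
move=> le_pN; rewrite /alpha linearD /= ev4_s3412.
have -> : posn (N%:Z - p%:Z + 1) = (N - p).+1.
  by have -> : N%:Z - p%:Z + 1 = (N - p).+1%:Z by lia.
have -> : posn (N%:Z - p%:Z) = (N - p)%N.
  by have -> : N%:Z - p%:Z = (N - p)%N%:Z by lia.
rewrite !linear_sum; congr (_ + _); apply: eq_bigr => s _ /=;
  congr (ev4 _ _ _ _ (ucomp _ _ _ _)); have := ltn_ord s; lia.
Qed.

(** When the last two arguments agree, the two terms merge and Pascal's rule adds their coefficients
    to C(i + m - 1, m - 1). Modulo 2 this is C(j - 1, m - 1), the outer coefficient is C(n - j - 1,
    m - 1), and their product is symmetric in j and n - j. *)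
Lemma ev4_ucomp_sym m n x a b c : (0 < m)%N ->
  ev4 a b c c (ucomp e m n%:Z x) =
  \sum_(j < n.+1) if odd (binp j m.-1) && odd (binp (n - j) m.-1) then
    (if odd m.-1 then cup e x (cup e (n - j)%N c c) (cup e j a b)
     else cup e x (cup e j a b) (cup e (n - j)%N c c)) else 0.
Proof.
move=> m0; case: n => [|n]; first by rewrite big_ord1 ev4_ucomp0.
rewrite ev4_ucomp //; apply: eq_bigr => j _ /=.
set r := (trunc_log 2 m).+1; set i := oppmod _ _.
have lt_m : (m.-1 < 2 ^ r)%N by rewrite (leq_ltn_trans (leq_pred _))
  ?trunc_log_ltn.
have lt_i : (i < 2 ^ r)%N by rewrite ltn_oppmod ?expn_gt0.
have dvd_i : (2 ^ r %| i + j)%N by rewrite dvdn_oppmod ?expn_gt0.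
rewrite -scalerDl scalerA -natrD -natrM scale_natF2 oddM oddD.
rewrite (odd_bin_submod (r := r) (j := j) (n := n.+1)) // -1?ltnS //.
rewrite -(odd_bin_oppmod lt_i lt_m dvd_i) andbC.
have -> : odd 'C(i + m, m) (+) odd 'C((i + m).-1, m) = odd 'C(i + m.-1, m.-1).
  by case: (m) m0 => // k _; rewrite addnS /= binS oddD addbAC addbb.
by [].
Qed.

(** This kills the terms s > 0 of the first sum of alpha_(N,0). The outer coefficient C(s - j - 1,
    s) survives only at j = s, where the inner ones reduce to C(s - 1, s + 1) and C(0, s + 1), both
    zero. *)
Lemma ev4_ucompS s x a b c d : (0 < s)%N -> ev4 a b c d (ucomp e s.+1 s x) = 0.
Proof.
move=> s0; rewrite ev4_ucomp //; apply: big1 => j _ /=.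
set r := (trunc_log 2 s.+1).+1; set i := oppmod _ _.
have lt_s : (s.+1 < 2 ^ r)%N by rewrite trunc_log_ltn.
have lt_i : (i < 2 ^ r)%N by rewrite ltn_oppmod ?expn_gt0.
have dvd_i : (2 ^ r %| i + j)%N by rewrite dvdn_oppmod ?expn_gt0.
rewrite scale_natF2 (odd_bin_submod (r := r) (j := j) (n := s)) //;
  last 2 first.
- by rewrite -ltnS.
- exact: ltnW.
have [lt_js|ge_js] := ltnP j s.
  rewrite (_ : (s - j = (s - j).-1.+1)%N) /=; last by lia.
  by rewrite bin_small //; lia.
have js : j = s :> nat by have := ltn_ord j; lia.
rewrite js subnn /= in dvd_i *; rewrite !scale_natF2.
rewrite (odd_bin_oppmod lt_i lt_s dvd_i) -(prednK s0) /= bin_small ?prednK //.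
rewrite addnS (odd_bin_mod (r := r) (b := 0%N)) // ?(eqP dvd_i) ?mod0n //.
by rewrite bin0n addr0.
Qed.

(** These elements make up the second sum of alpha_(N,0). The outer coefficient C(m - j, m) leaves j
    = 0 and j = m + 1, where it reads C(-1, m); the inner ones keep the unswapped term in the first
    case and the swapped term in the second. *)
Lemma ev4_ucomp_diag m x a b c d :
  ev4 a b c d (ucomp e m.+1 m.+1 x) =
  if odd m then cup e x (cup e m.+1 c d) (cup e 0 a b) +
                cup e x (cup e 0 d c) (cup e m.+1 a b)
  else cup e x (cup e 0 a b) (cup e m.+1 c d) +
       cup e x (cup e m.+1 a b) (cup e 0 d c).
Proof.
rewrite ev4_ucomp //.
set r := (trunc_log 2 m.+1).+1.
have lt_m : (m.+1 < 2 ^ r)%N by rewrite trunc_log_ltn.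
have lt_m1 : (m < 2 ^ r)%N by apply: leq_ltn_trans lt_m.
have lt_i j : (oppmod (2 ^ r) j < 2 ^ r)%N by rewrite ltn_oppmod ?expn_gt0.
have dvd_i j : (2 ^ r %| oppmod (2 ^ r) j + j)%N by rewrite dvdn_oppmod
  ?expn_gt0.
rewrite big_ord_recl big_ord_recr /= big1 ?add0r.
  rewrite !scale_natF2.
  rewrite !(odd_bin_submod (r := r) (n := m.+1) _ lt_m1 (dvd_i _)) //.
  rewrite !(odd_bin_oppmod (lt_i _) lt_m (dvd_i _)) subnn subn0 /=.
  have -> : odd 'C((oppmod (2 ^ r) 0 + m.+1).-1, m.+1) = false.
    by rewrite /oppmod mod0n subn0 modnn add0n bin_small.
  have -> : odd 'C((oppmod (2 ^ r) (bump 0 m) + m.+1).-1, m.+1) = true.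
    apply: (odd_bin_pred_dvdn (r := r)) => //.
    by rewrite prednK ?addnS //; have := dvd_i m.+1; rewrite addnS.
  rewrite /bump /= add0n (bin_small (ltnSn m)) add0r addr0.
  by rewrite binn; case: (odd m).
move=> j _; rewrite scale_natF2 /=.
rewrite (odd_bin_submod (r := r) (n := m.+1) _ lt_m1 (dvd_i _)) //; last first.
  exact: leqW.
have := ltn_ord j; rewrite /bump /= add1n subSS => lt_jm.
rewrite (_ : (m - j = (m - j).-1.+1)%N) /=; last by lia.
by rewrite bin_small //; lia.
Qed.
End Composite.

(** * Relations between cocycles *)

Definition coboundary (V : dgSpace) (x : V) : Prop := exists y, x = diff V y.

Section Coboundary.
Variable V : dgSpace.
Implicit Types x y : V.

Lemma cobd0 : coboundary (0 : V).
Proof. by exists 0; rewrite linear0. Qed.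

Lemma cobdD x y : coboundary x -> coboundary y -> coboundary (x + y).
Proof. by move=> [x' ->] [y' ->]; exists (x' + y'); rewrite linearD. Qed.

Lemma cobdZ c x : coboundary x -> coboundary (c *: x).
Proof. by move=> [x' ->]; exists (c *: x'); rewrite linearZ. Qed.

Lemma cobd_sum (I : Type) (r : seq I) (P : pred I) (F : I -> V) :
  (forall i, P i -> coboundary (F i)) -> coboundary (\sum_(i <- r | P i) F i).
Proof. by move=> cF; elim/big_ind: _ => //; [exact: cobd0 | exact: cobdD]. Qed.

(** In characteristic 2, [coboundary (x + y)] says that x and y are homologous; the relations below
    are stated in this form and chained by transitivity. *)
Lemma cobd_trans x y z : coboundary (x + y) -> coboundary (y + z) ->
  coboundary (x + z).
Proof. by move=> xy yz; have := cobdD xy yz; rewrite -addrA addvKv. Qed.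

(** The terms j and n - j cancel in pairs up to coboundaries; a middle term is left over when n is
    even. *)
Lemma cobd_fold n (f : nat -> V) :
  (forall j, (j <= n)%N -> coboundary (f j + f (n - j)%N)) ->
  coboundary (\sum_(j < n.+1) f j + if odd n then 0 else f n./2).
Proof.
have [k] := ubnP n; elim: k n f => // k IH [|[|n]] f lt_n cf.
- by rewrite big_ord1 /= addvv; apply: cobd0.
- by rewrite !big_ord_recl big_ord0 /= !addr0; apply: (cf 0%N).
rewrite big_ord_recl big_ord_recr /= negbK.
have /IH H : (n < k)%N by apply: ltnW.
have {}H := H (fun j => f j.+1); have c0 := cf 0%N isT.
rewrite (AC (1*(1*1)*1) ((1*3)*(2*4))) /=; apply: cobdD; first exact: c0.
by apply: H => j le_jn; rewrite -subSn //; apply: (cf j.+1); rewrite ltnS ltnW.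
Qed.

End Coboundary.

(** * Level, Cartan and Adem relations for cocycles *)

Section ChainRelations.
Variables (L : dgOperad) (A : opAlgebra L).
Variables (e : nat -> L 2%N) (G : nat -> nat -> L 4%N).
Hypothesis levP : is_levAC e G.
Implicit Types a b c d : A.

Let dcup := cup_diff (A := A) (lev_e_diff levP).

Lemma cupDl i a b c : cup e i (a + b) c = cup e i a c + cup e i b c.
Proof. by have := cup_linearl e i c 1 a b; rewrite !scale1r. Qed.

Lemma cupDr i a b c : cup e i c (a + b) = cup e i c a + cup e i c b.
Proof. by have := cup_linearr e i c 1 a b; rewrite !scale1r. Qed.

Lemma cup0l i b : cup e i (0 : A) b = 0.
Proof. by have := cupDl i 0 0 b; rewrite addr0 addvv. Qed.

Lemma cup0r i a : cup e i a (0 : A) = 0.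
Proof. by have := cupDr i 0 0 a; rewrite addr0 addvv. Qed.

Lemma cup_cocycle a b : diff A a = 0 -> diff A b = 0 -> diff A (cup e 0 a b) =
  0.
Proof. by move=> a0 b0; rewrite dcup a0 b0 cup0l cup0r
  !(@cup_lt0 _ _ _ (0 - 1)) ?addr0 //; lia. Qed.

Lemma cup_sq_cocycle i a : diff A a = 0 -> diff A (cup e i a a) = 0.
Proof. by move=> a0; rewrite dcup a0 cup0l cup0r addvv !addr0. Qed.

Lemma cup_comm i a b : diff A a = 0 -> diff A b = 0 ->
  coboundary (cup e i a b + cup e i b a).
Proof.
move=> a0 b0; exists (cup e (i + 1) a b).
by rewrite dcup a0 b0 cup0l cup0r !addr0 addrK.
Qed.

(** This serves to make the squares independent of the representative. The summand e_(i-1)(a, a) of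
    the primitive cancels what d(e_i) contributes to the differential of e_i(a, da). *)
Lemma cup_diff_diff i a :
  coboundary (cup e i (diff A a) (diff A a)).
Proof.
exists (cup e i a (diff A a) + cup e (i - 1) a a).
rewrite linearD /= !dcup diffK cup0r addr0 addvv add0r.
by rewrite (AC ((1*1)*1*(1*1)) (3*(1*5)*(2*4))) /= !addvv !addr0.
Qed.

Lemma lev_cobd m n a b c d : (0 < m <= n)%N ->
  diff A a = 0 -> diff A b = 0 -> diff A c = 0 -> diff A d = 0 ->
  coboundary (ev4 a b c d (diffG e G m n)).
Proof.
move=> mn a0 b0 c0 d0; exists (ev4 a b c d (G m n)).
by rewrite ev4_diff // (lev_G_diff levP).
Qed.

(** Here alpha_(0,0) is e_0(e_0, e_0), the G-terms of dG^1_1 are zero, and (3214) exchanges a and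
    c. *)
Lemma cup_level a b c d :
  diff A a = 0 -> diff A b = 0 -> diff A c = 0 -> diff A d = 0 ->
  coboundary (cup e 0 (cup e 0 a b) (cup e 0 c d) +
              cup e 0 (cup e 0 c b) (cup e 0 a d)).
Proof.
move=> a0 b0 c0 d0; have := lev_cobd (m := 1) (n := 1) isT a0 b0 c0 d0.
rewrite /diffG /= /idp !linear0 !addr0 add0r linearD /= ev4_s3214.
by rewrite !ev4_alpha // !subn0 !big_ord1 !big_ord0 !addr0 /= !addn0
  !ev4_ucomp0.
Qed.

(** The permutation (2143) fixes (a, a, b, b), so the G-term cancels against itself; (3214) turns
    the arguments into (b, a, a, b). *)
Lemma cartan_lev (N : nat) a b : diff A a = 0 -> diff A b = 0 ->
  coboundary (ev4 a a b b (alpha e N N) + ev4 b a a b (alpha e N 0)).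
Proof.
move=> a0 b0; have := lev_cobd (m := 1) (n := N.+1) isT a0 a0 b0 b0.
rewrite /diffG /idp /Gz /= subr0 linearD /= ev4_s3214 linearD /= linearD /=.
rewrite !linear0 addr0 linear0 addr0.
by case: N => [|N] /=; rewrite ?linear0 ?addr0 ?linear0 ?add0r // linearD /=
  ev4_s2143 addvv add0r.
Qed.

(** The index m = 2p + 1 is chosen so that (m - 1)/2 = p; each G-term has the form [idp s o], which
    is zero on four equal arguments. *)
Lemma adem_lev (N p : nat) a : (p.*2 <= N)%N -> diff A a = 0 ->
  coboundary (ev4 a a a a (alpha e N (N - p)%N) + ev4 a a a a (alpha e N p)).
Proof.
move=> le_pN a0; have := lev_cobd (m := p.*2.+1) (n := N.+1) _ a0 a0 a0 a0.
rewrite /= ltnS le_pN => /(_ isT); rewrite /diffG /= half_double.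
have -> : N%:Z - p%:Z = (N - p)%N by lia.
have idp0 s o : (forall o, ev4 a a a a (oact s o) = ev4 a a a a o) ->
    ev4 a a a a (idp s o) = 0.
  by move=> sa; rewrite /idp linearD /= sa addvv.
rewrite linearD /= ev4_s3214 linearD /= linearD /=
  [ev4 _ _ _ _ (idp s4321 _)]idp0.
  rewrite addr0; case: ifP => _; rewrite idp0 ?add0r // => o; exact: ev4_s2143.
by move=> o; apply: ev4_s4321.
Qed.

(** Only u^1_N remains, and for m = 1 all the coefficients are odd. *)
Lemma ev4_alphaNN (N : nat) a b : ev4 a a b b (alpha e N N) =
  \sum_(j < N.+1) cup e 0 (cup e j a a) (cup e (N - j)%N b b).
Proof.
rewrite ev4_alpha // subnn big_ord0 addr0 big_ord1 add0n sub0n ev4_ucomp_sym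
  //=.
have binp0 j : binp j 0 = 1%N by case: j => //= j; rewrite bin0.
by apply: eq_bigr => j _; rewrite !binp0.
Qed.

(** By [ev4_ucompS] the first sum reduces to e_N(e_0(b, a), e_0(a, b)). Exchanging a and b in its
    first entry costs a coboundary and a remainder, which the terms of the second sum push to lower
    and lower outer index. *)
Lemma alphaN0_cobd (N : nat) a b : diff A a = 0 -> diff A b = 0 ->
  coboundary (cup e N (cup e 0 a b) (cup e 0 a b) + ev4 b a a b (alpha e N 0)).
Proof.
move=> a0 b0; rewrite ev4_alpha // subn0 big_ord_recl big1 ?addr0 => [|s _];
  last first.
  by rewrite addn0 ev4_ucompS.
rewrite addn0 !subn0 ev4_ucomp0 /=.
set z0 := cup e 0 a b; have z00 : diff A z0 = 0 by apply: cup_cocycle.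
(* [r k] is the remainder after k terms of the second sum; [r N] is zero because its outer index is
   - 1. *)
pose r k := cup e (N%:Z - k%:Z - 1) (cup e k.+1 a b) z0 +
            cup e (N%:Z - k%:Z - 1) z0 (cup e k.+1 a b).
pose t k := ev4 a b b a (ucomp e k.+1 (k + 0).+1 (N - k.+1)%N).
suff H k : (k <= N)%N -> coboundary (cup e N z0 z0 +
    (cup e N (cup e 0 b a) z0 + \sum_(s < k) t s) + r k).
  have := H N (leqnn N); by rewrite /r subrr !(@cup_lt0 _ _ _ (0 - 1)) ?addr0
    //; lia.
elim: k => [|k IH] le_kN.
  (* Since d e_1(a, b) = e_0(a, b) + e_0(b, a), this primitive performs the exchange in the first
     entry. *)
  exists (cup e N (cup e 1 a b) z0).
  rewrite big_ord0 addr0 dcup z00 cup0r addr0 dcup a0 b0 cup0l cup0r addr0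
    addr0.
  by rewrite subrr cupDl addrC /r subr0.
have := IH (ltnW le_kN).
rewrite big_ord_recr /=.
set S := cup e N z0 z0; set w := cup e N _ _; set T := \sum_(_ < _) _ => H.
suff H' : coboundary (r k + (t k + r k.+1)).
  by have := cobd_trans H H'; rewrite !addrA.
(* The primitive is [sum_k e_(N-k) T^k (e_(k+1)(a, b), z0)], where [T] exchanges
   the arguments; [h] is its next term. *)
pose h := if odd k then cup e (N%:Z - k.+1%:Z) (cup e k.+2 a b) z0
          else cup e (N%:Z - k.+1%:Z) z0 (cup e k.+2 a b).
exists h; rewrite /h /t addn0 ev4_ucomp_diag.
have dz : diff A (cup e k.+2 a b) = cup e k.+1 a b + cup e k.+1 b a.
  by rewrite dcup a0 b0 cup0l cup0r addr0 addr0;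
    congr (cup _ _ _ _ + cup _ _ _ _); lia.
have -> : N%:Z - k.+1%:Z = (N - k.+1)%N by lia.
rewrite /r; have -> : N%:Z - k%:Z - 1 = (N - k.+1)%N by lia.
have -> : N%:Z - k.+1%:Z - 1 = (N - k.+1)%N%:Z - 1 by lia.
rewrite -/z0; case: (odd k); rewrite dcup z00 dz ?cup0r ?cup0l ?addr0 ?add0r
  ?cupDl ?cupDr.
  by rewrite (AC ((1*1)*((1*1)*(1*1))) (((5*6)*(1*3))*(2*4))) /= addvv addr0.
by rewrite (AC ((1*1)*((1*1)*(1*1))) (((6*5)*(2*3))*(1*4))) /= addvv addr0.
Qed.

Lemma cup_cartan (N : nat) a b : diff A a = 0 -> diff A b = 0 ->
  coboundary (cup e N (cup e 0 a b) (cup e 0 a b) +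
    \sum_(j < N.+1) cup e 0 (cup e j a a) (cup e (N - j)%N b b)).
Proof.
move=> a0 b0; rewrite -ev4_alphaNN; apply: cobd_trans (alphaN0_cobd N a0 b0) _.
by rewrite addrC; apply: cartan_lev.
Qed.

(* Up to a coboundary only the middle term of [u^(m+1)_n] survives on
   [(a, a, a, a)]: its coefficients are invariant under [j <-> n - j]. *)
Lemma ucomp_cobd m n x a : diff A a = 0 ->
  coboundary (ev4 a a a a (ucomp e m.+1 n%:Z x) +
    if odd n then 0 else
    if odd (binp n./2 m) then cup e x (cup e n./2 a a) (cup e n./2 a a) else 0).
Proof.
move=> a0; rewrite ev4_ucomp_sym //=.
pose f j := if odd (binp j m) && odd (binp (n - j) m) then
  (if odd m then cup e x (cup e (n - j)%N a a) (cup e j a a)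
   else cup e x (cup e j a a) (cup e (n - j)%N a a)) else 0.
have := @cobd_fold A n f.
have -> : (if odd n then 0 else f n./2) = (if odd n then 0 else
    if odd (binp n./2 m) then cup e x (cup e n./2 a a) (cup e n./2 a a) else 0).
  case: ifPn => // even_n; rewrite /f.
  have -> : (n - n./2 = n./2)%N by have := odd_double_half n; lia.
  by rewrite andbb if_same.
apply=> j le_jn; rewrite /f subKn // andbC.
case: ifP => _; last by rewrite addr0; apply: cobd0.
by case: (odd m); apply: cup_comm; apply: cup_sq_cocycle.
Qed.

(** For a cocycle a of degree n this represents Sq^(2n-N+j) Sq^(n-j) [a]. *)
Definition cup4 (N : int) (a : A) (j : nat) : A :=
  cup e (N - j.*2%:Z) (cup e j a a) (cup e j a a).

(** Each u^(s+1)_n leaves its middle term. For n = 2j the two sums contribute C(j - 1, n - p) and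
    C(j - 1, n - p - 1), which Pascal's rule adds to C(j, 2j - p), that is [bindouble p j]. *)
Lemma alpha_cobd (N p : nat) a : (p <= N)%N -> diff A a = 0 ->
  coboundary (ev4 a a a a (alpha e N p) +
    \sum_(j < N.+1) (bindouble p j)%:R *: cup4 N a j).
Proof.
move=> le_pN a0; rewrite ev4_alpha //.
pose E n := cup e (N%:Z - n%:Z) (cup e n./2 a a) (cup e n./2 a a).
pose B n k := if odd n then 0 else if odd (binp n./2 k) then E n else 0.
apply: (@cobd_trans _ _ (\sum_(s < (N - p).+1) B (s + p)%N s +
                         \sum_(s < N - p) B (s + p.+1)%N s)).
  rewrite (AC (2*2) ((1*3)*(2*4))) /= -!big_split /=.
  apply: cobdD; apply: cobd_sum => s _.
    have := @ucomp_cobd s (s + p)%N (N - p - s)%N a a0.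
    rewrite /B /E; have -> // : N%:Z - (s + p)%N%:Z = (N - p - s)%N%:Z.
    by have := ltn_ord s; lia.
  have := @ucomp_cobd s (s + p).+1 (N - p - s.+1)%N a a0.
  rewrite /B /E -addnS; have -> // : N%:Z - (s + p.+1)%N%:Z =
    (N - p - s.+1)%N%:Z.
  by have := ltn_ord s; lia.
pose B' q n := B n (n - q)%N.
have -> : \sum_(s < (N - p).+1) B (s + p)%N s = \sum_(n < N.+1) if (p <= n)%N
  then B' p n else 0.
  by rewrite -sum_shift 1?ltnW // subSn //; apply: eq_bigr => s _;
    rewrite /B' addnK.
have -> : \sum_(s < N - p) B (s + p.+1)%N s = \sum_(n < N.+1) if (p < n)%N
  then B' p.+1 n else 0.
  by rewrite -sum_shift // subSS; apply: eq_bigr => s _; rewrite /B' addnK.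
rewrite -big_split /=.
pose F n := if (p <= n)%N && odd 'C(n./2, n - p) then E n else 0.
rewrite (eq_bigr (fun n : 'I_N.+1 => if odd n then 0 else F n)) => [|n _];
  last first.
  rewrite /F /B' /B; case: (odd n); first by rewrite !if_same addr0.
  rewrite odd_binp subnS subn_gt0; case: (ltngtP p n) => // _ /=;
    last by rewrite addbF addr0.
    by do 2!case: (odd (binp _ _)); rewrite /= ?addvv ?addr0 ?add0r.
  by rewrite addr0.
(* The added terms n > N have the negative outer index N - n; the longer range fits [sum_even]. *)
have -> : \sum_(n < N.+1) (if odd n then 0 else F n) =
          \sum_(n < N.+1.*2) (if odd n then 0 else F n).
  rewrite -addnn big_split_ord /= [X in _ + X]big1 ?addr0 // => n _.
  rewrite /F /E cup_lt0 ?if_same //; lia.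
rewrite sum_even -big_split /= big1; first exact: cobd0.
move=> j _; rewrite scale_natF2 /F /E /cup4 /bindouble doubleK.
by case: (p <= _)%N; rewrite /= ?addvv ?addr0.
Qed.

(** Both alpha-terms of [adem_lev] are computed by [alpha_cobd]; this is the Bullett-Macdonald
    symmetry on cocycles. *)
Lemma bindouble_sym_cobd (N p : nat) a : (p.*2 <= N)%N -> diff A a = 0 ->
  coboundary (\sum_(j < N.+1) (bindouble p j + bindouble (N - p) j)%:R *: cup4
    N a j).
Proof.
move=> le_pN a0; under eq_bigr do rewrite natrD scalerDl.
rewrite big_split /=; have le_p : (p <= N)%N by lia.
apply: (@cobd_trans _ _ (ev4 a a a a (alpha e N p))).
  by rewrite addrC; apply: alpha_cobd.
apply: (@cobd_trans _ _ (ev4 a a a a (alpha e N (N - p)%N))).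
  by rewrite addrC; apply: adem_lev.
by apply: alpha_cobd; rewrite ?leq_subr.
Qed.

(** With n = |a|, s = n - j0 and t = 2n - N + j0, the hypothesis reads t < 2s, and this is the Adem
    relation for Sq^t Sq^s, indexed by j = n - i. *)
Lemma cup_adem (N j0 : nat) a : (3 * j0 < N)%N -> diff A a = 0 ->
  coboundary (cup4 N a j0 +
    \sum_(j < N.+1 | (j0 < j)%N && (N <= j.*2 + j0)%N)
       ('C(j - j0 - 1, j.*2 + j0 - N))%:R *: cup4 N a j).
Proof.
move=> lt_j0 a0.
have lt_N : (N < 2 ^ N)%N by apply: ltn_expl.
(* Modulo 2 and [x^(2^N)], [(1 + x)^M] is [(1 + x)^(- j0 - 1)], so that the
   combination of the symmetry relations with coefficients [C(M, j0 - p)] is the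
   residue against [(x (1 + x))^(- j0 - 1) dx]. *)
set M := ((2 ^ N).-1 - j0)%N.
have := @cobd_sum A _ (index_enum 'I_j0.+1) xpredT (fun p : 'I_j0.+1 =>
  ('C(M, j0 - p))%:R *: \sum_(j < N.+1) (bindouble p j + bindouble (N - p)
    j)%:R *: cup4 N a j).
have cb (p : 'I_j0.+1) : true -> coboundary (('C(M, j0 - p))%:R *:
    \sum_(j < N.+1) (bindouble p j + bindouble (N - p) j)%:R *: cup4 N a j).
  by move=> _; apply/cobdZ/bindouble_sym_cobd => //; have := ltn_ord p; lia.
move=> /(_ cb) {cb}.
under eq_bigr do rewrite scaler_sumr; rewrite exchange_big /=.
have -> // : \sum_(j < N.+1) \sum_(p < j0.+1) 'C(M, j0 - p)%:R *:
    ((bindouble p j + bindouble (N - p) j)%:R *: cup4 N a j) =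
  cup4 N a j0 + \sum_(j < N.+1 | (j0 < j)%N && (N <= j.*2 + j0)%N)
       ('C(j - j0 - 1, j.*2 + j0 - N))%:R *: cup4 N a j.
have lt_j0N : (j0 < N.+1)%N by lia.
rewrite [X in _ + X]big_mkcond (bigD1 (Ordinal lt_j0N)) //=.
rewrite [in RHS](bigD1 (Ordinal lt_j0N)) //= ltnn /= add0r.
(* The two Vandermonde sums give the coefficient of [cup4 N a j] for 2j <= N; for larger j that
   element is zero. *)
have coef (j : nat) : (j.*2 <= N)%N ->
    \sum_(p < j0.+1) 'C(M, j0 - p)%:R *: ((bindouble p j + bindouble (N - p)
      j)%:R *: cup4 N a j) =
    ((if j <= j0 then 'C(M + j, j0 - j) else 0) +
      (if N <= j.*2 + j0 then 'C(M + j, j.*2 + j0 - N) else 0))%N%:R *: cup4 N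
        a j.
  move=> le_j; rewrite -sum_bindouble -sum_bindouble_opp //.
  rewrite -big_split /= natr_sum scaler_suml; apply: eq_bigr => p _.
  by rewrite scalerA -natrM mulnDr.
congr (_ + _).
  (* At j = j0 the first summand is 1 and the second is absent, because 3 j0 < N. *)
  rewrite coef; last by lia.
  rewrite leqnn subnn bin0 ifF; last by lia.
  by rewrite addn0 scale1r.
apply: eq_bigr => j ne_j; have {ne_j} ne_j : (j != j0 :> nat) by [].
have [le_jN|gt_jN] := leqP j.*2 N; last first.
  have c0 : cup4 N a j = 0 by rewrite /cup4 cup_lt0 //; lia.
  by rewrite c0 big1 => [|p _]; rewrite !scaler0 ?if_same.
rewrite coef // scale_natF2 oddD; case: (ltngtP j j0) ne_j => // lt_j _ /=.
  (* For j < j0 put q = j0 - j: by reflection the coefficient has the parity of C(2q, q), which is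
     even. *)
  have -> : (N <= j.*2 + j0)%N = false by lia.
  have -> : (M + j = (2 ^ N).-1 - (j0 - j))%N by rewrite /M; lia.
  rewrite addbF -odd_bin_reflect ?odd_bin_double //; lia.
case: (leqP N (j.*2 + j0)) => //= le2.
(* For j > j0 the upper index is that of the Adem relation plus 2^N, a shift that preserves the
   parity. *)
have -> : (M + j = (j - j0 - 1) + 2 ^ N)%N by rewrite /M; lia.
by rewrite odd_bin_addexpn2 ?scale_natF2 //; lia.
Qed.

End ChainRelations.

(** * Operations on cohomology *)

Section Classes.
Variable V : dgSpace.
Implicit Types (a b : V) (x y : coh V).

Lemma has_class_cocycle a x : has_class a x -> diff V a = 0.
Proof. by move=> [z <- _]; apply/eqP; have := valP z. Qed.

Definition class_of a : coh V := coh_class (insubd (0 : cocycle V) a).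

Lemma has_class_of a : diff V a = 0 -> has_class a (class_of a).
Proof.
move=> a0; exists (insubd (0 : cocycle V) a) => //.
by rewrite insubdK // inE; apply/eqP.
Qed.

Definition rep x : V := val (generic_quotient.repr (x : cohomology V)).

Lemma has_class_rep x : has_class (rep x) x.
Proof. by exists (generic_quotient.repr (x : cohomology V)) => //;
  apply: coh_classK. Qed.

Lemma has_class_eq a b x y : has_class a x -> has_class b y ->
  coboundary (a + b) -> x = y.
Proof.
move=> [z <- <-] [w <- <-] [c cE]; apply/coh_classP; exists c.
by rewrite -cE oppv.
Qed.

Lemma has_class_fun a x y : has_class a x -> has_class a y -> x = y.
Proof. by move=> ax ay; apply: has_class_eq ax ay _; rewrite addvv;
  apply: cobd0. Qed.

Lemma has_class_cobd a b x : has_class a x -> has_class b x -> coboundary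
  (a + b).
Proof.
move=> [z <- <-] [w <- /esym/coh_classP[c cE]]; exists c.
by rewrite -cE oppv addrC.
Qed.

Lemma has_class0 : has_class (0 : V) 0.
Proof. by exists 0 => //; apply: linear0. Qed.

Lemma has_classD a b x y : has_class a x -> has_class b y ->
  has_class (a + b) (x + y).
Proof. by move=> [z <- <-] [w <- <-]; exists (z + w) => //;
  apply: coh_classD. Qed.

Lemma has_classZ c a x : has_class a x -> has_class (c *: a) (c *: x).
Proof. by move=> [z <- <-]; exists (c *: z) => //; apply: linearZ. Qed.

Lemma has_class_sum (I : Type) (r : seq I) (P : pred I) (F : I -> V)
    (X : I -> coh V) : (forall i, P i -> has_class (F i) (X i)) ->
  has_class (\sum_(i <- r | P i) F i) (\sum_(i <- r | P i) X i).
Proof.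
by move=> FX; elim/big_ind2: _ => //; [exact: has_class0 | move=> *;
  apply: has_classD].
Qed.

Lemma has_class_comp p a x : has_class a x ->
  has_class (gcomp V p a) (gcomp (coh V) p x).
Proof.
by move=> [z <- <-]; exists (cocycle_comp p z) => //;
  rewrite [RHS]coh_comp_class.
Qed.

Lemma homog_class p a x : homog p a -> has_class a x -> homog p x.
Proof.
by move=> pa ax; have := has_class_comp p ax; rewrite pa => /has_class_fun;
  apply.
Qed.

Lemma homog_rep p x : homog p x -> exists2 a, homog p a & has_class a x.
Proof.
move=> px; exists (gcomp V p (rep x)); first by rewrite /homog gcompK eqxx.
by rewrite -{2}px; apply/has_class_comp/has_class_rep.
Qed.

End Classes.

Section Homogeneous.
Variable V : gradedSpace.
Implicit Types x y : V.

Lemma homogD p x y : homog p x -> homog p y -> homog p (x + y).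
Proof. by rewrite /homog linearD => -> ->. Qed.

Lemma homog0 p : homog p (0 : V). Proof. exact: linear0. Qed.

Lemma gcomp_homog p q x : homog q x -> gcomp V p x = if p == q then x else 0.
Proof. by move=> qx; rewrite -{1}qx gcompK qx. Qed.

Lemma homog_ind (P : V -> Prop) : P 0 -> (forall x y, P x -> P y -> P (x + y))
  ->
  (forall p x, homog p x -> P x) -> forall x, P x.
Proof.
move=> P0 PD Ph x; have [s _ ->] := gcomp_sum x.
by elim/big_ind: _ => // p _; apply: (Ph p); rewrite /homog gcompK eqxx.
Qed.

Lemma gcomp_eq0 (s : seq int) x p :
  x = \sum_(q <- s) gcomp V q x -> p \notin s -> gcomp V p x = 0.
Proof.
move=> xE p_s; rewrite xE linear_sum big_seq big1 // => q q_s /=.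
by rewrite gcompK ifF //; apply: contraNF p_s => /eqP->.
Qed.

End Homogeneous.

(** * The product and the cup-i squares of classes *)

Section Cohomology.
Variables (L : dgOperad) (A : opAlgebra L).
Variables (e : nat -> L 2%N) (G : nat -> nat -> L 4%N).
Hypothesis levP : is_levAC e G.
Implicit Types (a : A) (b : steenrod) (x y : coh A).

Definition cohmul x y : coh A := class_of (cup e 0 (rep x) (rep y)).
Definition cohsq (i : int) x : coh A := class_of (cup e i (rep x) (rep x)).

(** Representatives are changed one at a time; each change adds the differential of an e_0-product,
    as d(e_0) = 0. *)
Lemma cohmul_class a (a' : A) x y : has_class a x -> has_class a' y ->
  has_class (cup e 0 a a') (cohmul x y).
Proof.
move=> ax yb; have [ca cb] := (has_class_cocycle ax, has_class_cocycle yb).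
have [rx ry] := (has_class_rep x, has_class_rep y).
have [crx cry] := (has_class_cocycle rx, has_class_cocycle ry).
have -> : cohmul x y = class_of (cup e 0 a a'); last first.
  by apply/has_class_of/(cup_cocycle levP).
apply: has_class_eq (has_class_of _) (has_class_of _) _;
  try exact: (cup_cocycle levP).
have [c cE] := has_class_cobd rx ax; have [d dE] := has_class_cobd ry yb.
apply: (@cobd_trans _ _ (cup e 0 a (rep y))).
  rewrite -cupDl cE; exists (cup e 0 c (rep y)).
  rewrite (cup_diff (lev_e_diff levP)) cry cup0r addr0.
  by rewrite !(@cup_lt0 _ _ _ (0 - 1)) ?add0r //; lia.
rewrite -cupDr dE; exists (cup e 0 a d).
rewrite (cup_diff (lev_e_diff levP)) ca cup0l add0r.
by rewrite !(@cup_lt0 _ _ _ (0 - 1)) ?add0r //; lia.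
Qed.

(** The values e_i(a + dc, a + dc) and e_i(a, a) differ by a symmetrized cross term and by e_i(dc,
    dc), both coboundaries. *)
Lemma cohsq_class i a x : has_class a x -> has_class (cup e i a a) (cohsq i x).
Proof.
move=> ax; have ca := has_class_cocycle ax.
have rx := has_class_rep x; have crx := has_class_cocycle rx.
have -> : cohsq i x = class_of (cup e i a a); last first.
  by apply/has_class_of/(cup_sq_cocycle levP).
apply: has_class_eq (has_class_of _) (has_class_of _) _;
  try exact: (cup_sq_cocycle levP).
have [c cE] := has_class_cobd rx ax; have -> : rep x = a + diff A c.
  by rewrite -cE addrCA addvv addr0.
rewrite cupDl !cupDr.
rewrite (AC ((1*1)*(1*1)*1) ((1*5)*((2*3)*4))) /= addvv add0r.
apply: cobdD; last exact: (cup_diff_diff levP).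
by apply: (cup_comm levP); rewrite ?diffK.
Qed.

Lemma cohmulDl x y z : cohmul (x + y) z = cohmul x z + cohmul y z.
Proof.
have [[rx ry] rz] := (has_class_rep x, has_class_rep y, has_class_rep z).
apply: has_class_fun (cohmul_class (has_classD rx ry) rz) _.
by rewrite cupDl; apply: has_classD; apply: cohmul_class.
Qed.

Lemma cohmulC x y : cohmul x y = cohmul y x.
Proof.
have [rx ry] := (has_class_rep x, has_class_rep y).
apply: has_class_eq (cohmul_class rx ry) (cohmul_class ry rx) _.
by apply: (cup_comm levP); apply: has_class_cocycle; [exact: rx | exact: ry].
Qed.

Lemma cohmulDr x y z : cohmul z (x + y) = cohmul z x + cohmul z y.
Proof. by rewrite !(cohmulC z) cohmulDl. Qed.

Lemma cohmul0l x : cohmul 0 x = 0.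
Proof. by have := cohmulDl 0 0 x; rewrite addr0 addvv. Qed.

Lemma cohmul0r x : cohmul x 0 = 0.
Proof. by rewrite cohmulC cohmul0l. Qed.

Lemma cohmul_homog p q x y :
  homog p x -> homog q y -> homog (p + q) (cohmul x y).
Proof.
move=> /homog_rep[a pa ax] /homog_rep[b qb yb].
apply: homog_class (cohmul_class ax yb).
by have := cup_homog (lev_e_deg levP) 0 pa qb; rewrite subr0.
Qed.

Lemma cohmul_level x y z t :
  cohmul (cohmul x y) (cohmul z t) = cohmul (cohmul x z) (cohmul y t).
Proof.
(* [cup_level] exchanges the first and third arguments, so the left factors are commuted first. *)
rewrite (cohmulC x y) (cohmulC x z).
have [rx ry] := (has_class_rep x, has_class_rep y).
have [rz rt] := (has_class_rep z, has_class_rep t).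
apply: has_class_eq (cohmul_class (cohmul_class ry rx) (cohmul_class rz rt))
  (cohmul_class (cohmul_class rz rx) (cohmul_class ry rt)) _.
by apply: (cup_level levP); apply: has_class_cocycle;
  [exact: ry | exact: rx | exact: rz | exact: rt].
Qed.

Lemma cohsq_lt0 i x : i < 0 -> cohsq i x = 0.
Proof.
move=> i0; apply: has_class_fun (cohsq_class i (has_class_rep x)) _.
by rewrite cup_lt0 //; apply: has_class0.
Qed.

(** The cross terms e_i(a, b) + e_i(b, a) are the coboundary of e_(i+1)(a, b). *)
Lemma cohsqD i x y : cohsq i (x + y) = cohsq i x + cohsq i y.
Proof.
have [rx ry] := (has_class_rep x, has_class_rep y).
apply: has_class_eq (cohsq_class i (has_classD rx ry))
  (has_classD (cohsq_class i rx) (cohsq_class i ry)) _.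
rewrite cupDl !cupDr (AC ((1*1)*(1*1)*(1*1)) (((1*5)*(4*6))*(2*3))) /= !addvv
  !add0r.
by apply: (cup_comm levP); apply: has_class_cocycle; [exact: rx | exact: ry].
Qed.

Lemma cohsq0 i : cohsq i 0 = 0.
Proof. by have := cohsqD i 0 0; rewrite addr0 addvv. Qed.

Lemma cohsq_homog i p x : homog p x -> homog (p + p - i) (cohsq i x).
Proof.
move=> /homog_rep[a pa ax]; apply: homog_class (cohsq_class i ax).
exact: (cup_homog (lev_e_deg levP)).
Qed.

Lemma cohsq_mul x : cohsq 0 x = cohmul x x.
Proof.
have rx := has_class_rep x.
exact: has_class_fun (cohsq_class 0 rx) (cohmul_class rx rx).
Qed.

Lemma cohsq_cartan (N : nat) x y : cohsq N (cohmul x y) =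
  \sum_(j < N.+1) cohmul (cohsq j x) (cohsq (N - j)%N y).
Proof.
have [rx ry] := (has_class_rep x, has_class_rep y).
have [cx cy] := (has_class_cocycle rx, has_class_cocycle ry).
apply: has_class_eq (cohsq_class N (cohmul_class rx ry)) _
  (cup_cartan levP N cx cy).
by apply: has_class_sum => j _; apply: cohmul_class; apply: cohsq_class.
Qed.

Lemma cohsq_adem (N j0 : nat) x : (3 * j0 < N)%N ->
  cohsq (N%:Z - j0.*2%:Z) (cohsq j0 x) =
  \sum_(j < N.+1 | (j0 < j)%N && (N <= j.*2 + j0)%N)
    ('C(j - j0 - 1, j.*2 + j0 - N))%:R *: cohsq (N%:Z - j.*2%:Z) (cohsq j x).
Proof.
move=> lt_j0; have rx := has_class_rep x; have cx := has_class_cocycle rx.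
apply: has_class_eq _ _ (cup_adem levP lt_j0 cx);
  first by do 2!apply: cohsq_class.
by apply: has_class_sum => j _; apply: has_classZ; do 2!apply: cohsq_class.
Qed.

(** The cup index p - r depends on the degree, so the operation is defined on homogeneous parts;
    finitely many of them are nonzero. *)
Definition cohSq (r : int) x : coh A :=
  \sum_(p \in [set: int]) cohsq (p - r) (gcomp (coh A) p x).

Lemma cohSqE r (s : seq int) x : uniq s ->
  (forall p, p \notin s -> gcomp (coh A) p x = 0) ->
  cohSq r x = \sum_(p <- s) cohsq (p - r) (gcomp (coh A) p x).
Proof.
by move=> us xs; apply: fsum_seq => // p p_s; rewrite xs ?cohsq0.
Qed.

Lemma cohSqD r : {morph cohSq r : x y / x + y}.
Proof.
move=> x y; have [s1 u1 x1] := gcomp_sum x; have [s2 u2 y2] := gcomp_sum y.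
have us := undup_uniq (s1 ++ s2).
have xs p : p \notin undup (s1 ++ s2) -> gcomp (coh A) p x = 0.
  by rewrite mem_undup mem_cat negb_or => /andP[ps _]; apply: gcomp_eq0 x1 ps.
have ys p : p \notin undup (s1 ++ s2) -> gcomp (coh A) p y = 0.
  by rewrite mem_undup mem_cat negb_or => /andP[_ ps]; apply: gcomp_eq0 y2 ps.
rewrite !(cohSqE _ us) // => [|p ps]; last by rewrite linearD xs ?ys ?addr0.
by rewrite -big_split; apply: eq_bigr => p _; rewrite linearD cohsqD.
Qed.

Lemma cohSq_homog r p x : homog p x -> cohSq r x = cohsq (p - r) x.
Proof.
move=> px; rewrite (@cohSqE r [:: p]) ?big_seq1 ?px // => q.
by rewrite inE => /negPf qp; rewrite (gcomp_homog q px) qp.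
Qed.

(** * The action of the Steenrod algebra *)

Fixpoint term_act (u : sqTerm) x : coh A :=
  match u with
  | TSq r => cohSq r x
  | TZero => 0
  | TOne => x
  | TAdd u v => term_act u x + term_act v x
  | TMul u v => term_act u (term_act v x)
  end.

Lemma term_actD u : {morph term_act u : x y / x + y}.
Proof.
elim: u => //= [r|x y|u IHu v IHv x y|u IHu v IHv x y].
- exact: cohSqD.
- by rewrite addr0.
- by rewrite IHu IHv addrACA.
- by rewrite IHv IHu.
Qed.

(** On a class of degree n, put k = n - i in the Adem sum: [cohsq_adem] applies with j0 = n - s and
    N = 3n - s - t, and t < 2s becomes 3 j0 < N. *)
Lemma term_act_adem (t s : int) x : t < 2 * s ->
  cohSq t (cohSq s x) = term_act (adem_rhs t s) x.
Proof.
move=> ts; elim/homog_ind: x => [|x y IHx IHy|n x nx].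
- have cohSq0 r : cohSq r 0 = 0 by have := cohSqD r 0 0; rewrite addr0 addvv.
  have act0 u : term_act u 0 = 0 by have := term_actD u 0 0;
    rewrite addr0 addvv.
  by rewrite act0 !cohSq0.
- by rewrite !cohSqD IHx IHy term_actD.
have sqsq u v : cohSq u (cohSq v x) = cohsq (n + v - u) (cohsq (n - v) x).
  have vx := cohsq_homog (n - v) nx.
  rewrite (cohSq_homog v nx) (cohSq_homog u vx); congr cohsq; lia.
rewrite sqsq.
pose F (k : int) : coh A := binz (k - (n - s) - 1) (2 * k - (2 * n - t)) *:
  cohsq (3 * n - s - t - 2 * k) (cohsq k x).
have F_supp k : F k <> 0 -> [/\ 0 <= k, 2 * k <= 3 * n - s - t, n - s < k,
    2 * n - t <= 2 * k & k <= n - t + s - 1].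
  rewrite /F => Fk; have bk : binz (k - (n - s) - 1) (2 * k - (2 * n - t)) <> 0.
    by move=> b0; apply: Fk; rewrite b0 scale0r.
  have k0 : 0 <= k by case: (ltP k 0) => // k0; case: Fk;
    rewrite (cohsq_lt0 _ k0) cohsq0 scaler0.
  have k1 : 2 * k <= 3 * n - s - t.
    by case: (leP (2 * k) (3 * n - s - t)) => // k1; case: Fk;
      rewrite cohsq_lt0 ?scaler0 //; lia.
  move: bk; rewrite /binz; case E1: (_ - 1) => [u|u] //;
    case E2: (2 * k - _) => [v|v] //.
  by case: (leqP v u) => uv; [split; lia | rewrite bin_small].
transitivity (\sum_(k \in [set: int]) F k).
  have [j0|j0] := ltP (n - s) 0.
    (* For n < s the left side is zero, and the bounds 2n - t <= 2k <= 3n - s - t on the support of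
       [F] are incompatible. *)
    rewrite (cohsq_lt0 _ j0) cohsq0 fsbig1 // => k _;
      apply/eqP/negPn/negP => /eqP /F_supp[]; lia.
  have [j Ej] : exists j : nat, n - s = j%:Z by exists (absz (n - s)%R); lia.
  have [N EN] : exists N : nat, 3 * n - s - t = N%:Z by exists
    (absz (3 * n - s - t)%R); lia.
  have -> : n + s - t = N%:Z - j.*2%:Z by lia.
  rewrite Ej cohsq_adem; last by lia.
  rewrite (fsum_seq (s := map Posz (iota 0 N.+1))).
  - have -> : iota 0 N.+1 = index_iota 0 N.+1 by rewrite /index_iota subn0.
    rewrite big_map big_mkord big_mkcond; apply: eq_bigr => k _; rewrite /F.
    have -> : 3 * n - s - t - 2 * k%:Z = N%:Z - k.*2%:Z by lia.
    rewrite Ej; case: ifP => [/andP[lt_jk le_N]|out].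
      have -> : k%:Z - j%:Z - 1 = (k - j - 1)%N by lia.
      by have -> : 2 * k%:Z - (2 * n - t) = (k.*2 + j - N)%N by lia.
    (* Outside the range of [cohsq_adem] an argument of the binomial is negative. *)
    have -> : binz (k%:Z - j%:Z - 1) (2 * k%:Z - (2 * n - t)) = 0.
      case: (ltnP j k) out => [lt_jk /= out|le_kj _].
        have [v ->] : exists v, 2 * k%:Z - (2 * n - t) = Negz v.
          by exists (N - (k.*2 + j)).-1; lia.
        by case: (_ - _ - _).
      have [v -> //] : exists v, k%:Z - j%:Z - 1 = Negz v.
      by exists (j - k)%N; lia.
    by rewrite scale0r.
  - by rewrite map_inj_uniq ?iota_uniq // => u v [].
  - move=> k; apply: contraNeq => /eqP/F_supp[k0 k1 _ _ _].
    by apply/mapP; exists (absz k); [rewrite mem_iota |]; lia.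
have sum_act M (P : pred nat) u : term_act (\big[TAdd/TZero]_(j < M | P j) u
  j) x =
    \sum_(j < M | P j) term_act (u j) x.
  by elim/big_rec2: _ => //= j v w _ ->.
rewrite /adem_rhs; set M := posn _; set i := fun j : nat => t - s + 1 + j%:Z.
rewrite (sum_act M (fun j => binz (s - i j - 1) (t - 2 * i j) != 0)
  (fun j => TMul (TSq (s + t - i j)) (TSq (i j)))) /=.
have inj_ni : injective (fun j => n - i j) by move=> j k; rewrite /i; lia.
rewrite (fsum_seq (s := map (fun j => n - i j) (iota 0 M))).
- have -> : iota 0 M = index_iota 0 M by rewrite /index_iota subn0.
  rewrite big_map big_mkord [RHS]big_mkcond; apply: eq_bigr => j _.
  rewrite /F sqsq.
  have -> : n - i j - (n - s) - 1 = s - i j - 1 by lia.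
  have -> : 2 * (n - i j) - (2 * n - t) = t - 2 * i j by lia.
  have -> : 3 * n - s - t - 2 * (n - i j) = n + i j - (s + t - i j) by lia.
  set c := binz _ _; by case: (F2_cases c) => ->; rewrite ?scale0r ?scale1r.
- by rewrite (map_inj_uniq inj_ni) iota_uniq.
move=> k; apply: contraNeq => /eqP/F_supp[_ _ _ k3 k4].
apply/mapP; exists (absz (n - k - (t - s + 1))%R); last by rewrite /i; lia.
by rewrite mem_iota /M /posn; case E: (_ + s) => /=; lia.
Qed.

Lemma term_act_cong u v x : sqCong u v -> term_act u x = term_act v x.
Proof.
move=> uv; elim: uv x => //= {u v}.
- by move=> u v w _ IHu _ IHv x; rewrite IHu.
- by move=> u u' v v' _ IHu _ IHv x; rewrite IHu IHv.
- by move=> u u' v v' _ IHu _ IHv x; rewrite IHv IHu.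
- by move=> u v w x; rewrite addrA.
- by move=> u v x; rewrite addrC.
- by move=> u x; rewrite add0r.
- by move=> u x; rewrite addvv.
- by move=> u v w x; rewrite term_actD.
- by move=> t s ts x; apply: term_act_adem.
Qed.

Definition coh_act (b : steenrod) x : coh A := term_act (sqrepr b) x.

Lemma coh_actE u x : coh_act (sqpi u) x = term_act u x.
Proof. exact/term_act_cong/sqreprP. Qed.

Lemma coh_act_Sq r x : coh_act (Sq r) x = cohSq r x.
Proof. exact: coh_actE. Qed.

Lemma coh_act_homog p q b x : steenrod_homog p b -> homog q x ->
  homog (p + q) (coh_act b x).
Proof.
move=> pb; elim: pb q x => {p b} [p|p b c _ IHb _ IHc||r|p r b c _ IHb _ IHc]
  q x qx.
- by rewrite [coh_act _ _]coh_actE; apply: homog0.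
- by rewrite [coh_act _ _]coh_actE; apply: homogD; [apply: IHb | apply: IHc].
- by rewrite [coh_act _ _]coh_actE add0r.
- rewrite coh_act_Sq (cohSq_homog r qx) (_ : r + q = q + q - (q - r));
  last by lia.
  exact: cohsq_homog.
- by rewrite [coh_act _ _]coh_actE -addrA; apply/IHb/IHc.
Qed.

Lemma coh_act_module : graded_steenrod_module coh_act.
Proof.
split=> [x|b|x|b c x|p q b x].
- by apply: F2_additive_linear => b c; rewrite [LHS]coh_actE.
- exact: F2_additive_linear (term_actD _).
- exact: coh_actE.
- exact: coh_actE.
- exact: coh_act_homog.
Qed.

Lemma cohmul_level_algebra : graded_level_algebra cohmul.
Proof.
split=> [y|x|p q x y|x y|x y z t].
- by apply: F2_additive_linear => x x'; apply: cohmulDl.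
- by apply: F2_additive_linear => y y'; apply: cohmulDr.
- exact: cohmul_homog.
- exact: cohmulC.
- exact: cohmul_level.
Qed.

(** This is [cohsq_cartan] with N = p + q - s and j = p - t; for other t one of the two cup indices
    is negative. *)
Lemma coh_act_cartan (s p q : int) x y : homog p x -> homog q y ->
  coh_act (Sq s) (cohmul x y) =
  \sum_(t \in [set: int]) cohmul (coh_act (Sq t) x) (coh_act (Sq (s - t)) y).
Proof.
move=> px qy; rewrite coh_act_Sq (cohSq_homog s (cohmul_homog px qy)).
pose F t := cohmul (cohsq (p - t) x) (cohsq (q - (s - t)) y).
rewrite (eq_fsbigr F) => [|t _]; last first.
  by rewrite !coh_act_Sq (cohSq_homog t px) (cohSq_homog (s - t) qy).
have F0 t : F t != 0 -> 0 <= p - t <= p + q - s.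
  apply: contraNT => out; rewrite /F; have [pt|pt] := ltP (p - t) 0.
    by rewrite (cohsq_lt0 _ pt) cohmul0l.
  by rewrite [cohsq (q - _) _]cohsq_lt0 ?cohmul0r //; lia.
have [N0|N0] := ltP (p + q - s) 0.
  rewrite cohsq_lt0 // fsbig1 // => t _; apply/eqP/negPn/negP => /F0; lia.
have [N EN] : exists N : nat, p + q - s = N%:Z by exists (absz (p + q - s)%R);
  lia.
rewrite EN in F0 *; rewrite cohsq_cartan.
rewrite (fsum_seq (s := map (fun j : nat => p - j%:Z) (iota 0 N.+1))).
- have -> : iota 0 N.+1 = index_iota 0 N.+1 by rewrite /index_iota subn0.
  rewrite big_map big_mkord; apply: eq_bigr => j _; have := ltn_ord j => lt_j.
  rewrite /F; have -> : p - (p - j%:Z) = j by lia.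
  by have -> : q - (s - (p - j%:Z)) = (N - j)%N by lia.
- by rewrite map_inj_uniq ?iota_uniq // => j k; lia.
move=> t; apply: contraNeq => /F0 t_in.
by apply/mapP; exists (absz (p - t)%R); [rewrite mem_iota |]; lia.
Qed.

Lemma coh_unstable_level_algebra : unstable_level_algebra cohmul coh_act.
Proof.
split=> [||n p x px lt_pn|p x px|s p q x y].
- exact: cohmul_level_algebra.
- exact: coh_act_module.
- by rewrite coh_act_Sq (cohSq_homog n px) cohsq_lt0 //; lia.
- by rewrite coh_act_Sq (cohSq_homog p px) subrr cohsq_mul.
- exact: coh_act_cartan.
Qed.

End Cohomology.

Theorem corollary3p3p5 (O : dgOperad) (acO : ademCartan O) (A : opAlgebra O) :
  exists (mul : coh A -> coh A -> coh A) (act : steenrod -> coh A -> coh A),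
    [/\ forall (a b : A) (x y : coh A), has_class a x -> has_class b y ->
          has_class (ev (ac_e acO 0) [tuple a; b]) (mul x y),
        forall (r n : int) (a : A) (x : coh A), homog n a -> has_class a x ->
          has_class (ev (ac_e acO (n - r)) [tuple a; a]) (act (Sq r) x)
      & unstable_level_algebra mul act].
Proof.
(* Restriction to Lev^AC keeps the underlying complex, hence the cohomology. *)
pose LA := restrict_alg (ac_hom acO) A; have levP := ac_levP acO.
have cupE i (a b : A) : ev (ac_e acO i) [tuple a; b] =
    cup (A := LA) (@ac_lev_e O acO) i a b.
  by case: i => [i|i] //; rewrite /cup /ev2 /= /restrict_ev linear0.
exists (cohmul (A := LA) (@ac_lev_e O acO)), (coh_act (A := LA)
  (@ac_lev_e O acO)).
split; last exact: (coh_unstable_level_algebra LA levP).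
- by move=> a b x y ax yb; rewrite cupE; exact:
  (@cohmul_class _ LA _ _ levP _ _ _ _ ax yb).
- move=> r n a x na ax; rewrite cupE (coh_act_Sq (A := LA) levP).
  rewrite (@cohSq_homog _ LA _ _ levP r n x (homog_class na ax)).
  exact: (@cohsq_class _ LA _ _ levP _ _ _ ax).
Qed.
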